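(* Let $n\ge 5$. The set $\mathcal{S}$ (the rotation complex) is a polyhedral complex. Moreover, $X\mapsto\overline{X}$ (topological closure) and $F\mapsto\operatorname{relint}F$ are mutually inverse bijections between $\mathcal{S}^\circ$ and $\mathcal{S}$. The following is true. (a) The rotation complex $\mathcal{S}$ is the common refinement of $\operatorname{dl}(N,S^{\vartriangle})$ and the flat TT-fan $\mathcal{T}$. (b) Two points $a,b$ in $|\operatorname{dl}(N,S^{\vartriangle})|$ are in the relative interior of the same face of the rotation complex $\mathcal{S}$ if, and only if, they are in the relative interior of the same face of $S^{\vartriangle}$ and $E^u(a)=E^u(b)$ for all $u\in V_n$.
   Context: Fix an integer $n\ge5$. Let $V_n=\{1,\dots,n\}$ and let $E_n$ be the set of all two-element subsets $uv:=\{u,v\}$ of $V_n$. Write $x\cdot y$ for the standard inner product on $\mathbb{R}^{E_n}$ and $\chi^F\in\{0,1\}^{E_n}$ for the characteristic vector of $F\subset E_n$. Polyhedra. $S\subset\mathbb{R}^{E_n}$ is the Symmetric Traveling Salesman Polytope, i.e. the convex hull of all $\chi^{E(C)}$, where $C$ ranges over the cycles with vertex set $V_n$ (Hamilton cycles of $K_n$). $P\subset\mathbb{R}^{E_n}$ is the Graphical Traveling Salesman Polyhedron, i.e. the convex hull of all $x\in\mathbb{Z}_+^{E_n}$ such that the multigraph on vertex set $V_n$ with $x_e$ copies of each edge $e$ is connected and Eulerian (all degrees even). It is known that $S$ is a face of $P$. Polar of $S$. For $u\in V_n$, $\delta_u\in\mathbb{R}^{E_n}$ has entry $1/2$ on all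 edges incident to $u$ and $0$ elsewhere; $\delta_u\cdot x=1$ holds for all $x\in S$. Let $L:=\{x\in\mathbb{R}^{E_n}\mid \delta_u\cdot x=0\ \forall u\in V_n\}$; its orthogonal complement $L^\perp$ is the span of the $\delta_u$. Let $z:=\frac{2}{n-1}\mathbf{1}$ (a relative interior point of $S$) and $$S^{\vartriangle}:=\{a\in L\mid (-a)\cdot(x-z)\le1\ \ \forall x\in S\}.$$ A point $a\in S^{\vartriangle}$ corresponds to the inequality $a\cdot x\ge a\cdot z-1$ valid for $S$; vertices of $S^{\vartriangle}$ correspond to facets of $S$. For $n\ge5$ every inequality $x_e\ge0$, $e\in E_n$, defines a facet of $S$; let $N$ be the set of the vertices of $S^{\vartriangle}$ corresponding to these facets, i.e. the vertices $a$ with $\{x\in S\mid a\cdot x=a\cdot z-1\}=\{x\in S\mid x_e=0\}$ for some $e\in E_n$. Polyhedral complexes. A polyhedral complex is a (finite) set of polyhedra closed under taking faces such that the intersection of any two members is a face of both; its members are called its faces. For such a $\mathcal{C}$, $|\mathcal{C}|$ denotes the union of its members. The empty polyhedron is disregarded when comparing complexes. The common refinement of $\mathcal{C}$ and $\mathcal{D}$ is $\{F\cap G\mid F\in\mathcal{C},G\in\mathcal{D}\}$. The complex $\operatorname{dl}(N,S^{\vartriangle})$ consists of all faces $F$ of $S^{\vartriangle}$ with $F\cap N=\emptyset$. Rotation. For $a\in|\operatorname{dl}(N,S^{\vartriangle})|$, let $\mathfrak{F}(a)$ be the set of all faces $F$ of $P$ for which there exists $q\in L^\perp$ such that the inequality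 $(a+q)\cdot x\ge a\cdot z-1+q\cdot z$ is valid for $P$ and $F=\{x\in P\mid (a+q)\cdot x=a\cdot z-1+q\cdot z\}$. Let $\mathcal{S}^\circ$ be the partition of $|\operatorname{dl}(N,S^{\vartriangle})|$ in which $a,b$ are in the same cell if and only if $\mathfrak{F}(a)=\mathfrak{F}(b)$. Let $\mathcal{S}:=\{\overline{X}\mid X\in\mathcal{S}^\circ\}$ be the set of the topological closures of its cells (the rotation complex). Flat TT-fan. For $a\in\mathbb{R}^{E_n}$ and distinct $u,v,w\in V_n$ let $t_{u,vw}(a):=a_{vu}+a_{uw}-a_{vw}$. The metric cone is $C:=\{d\in\mathbb{R}^{E_n}\mid t_{u,vw}(d)\ge0\text{ for all distinct }u,v,w\}$, and $F_{u,vw}$ is the face $\{d\in C\mid t_{u,vw}(d)=0\}$. Writing $\mathcal{C}(F)$ for the set of all faces of a polyhedron $F$, let $$\mathcal{T}':=\bigcap_{u\in V_n}\ \bigcup_{v,w\ne u}\mathcal{C}(F_{u,vw}).$$ With $p\colon\mathbb{R}^{E_n}\to L$ the orthogonal projection, the flat TT-fan is $\mathcal{T}:=\{p(F)\mid F\in\mathcal{T}'\}$. Edge sets. For $u\in V_n$ let $E^u(a):=\{vw\in E_n\mid u\ne v,w,\ t_{u,vw}(a)=\min_{v',w'\ne u}t_{u,v'w'}(a)\}$. *)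

(* Defs.v *)
From HB Require Import structures.
From mathcomp Require Import all_boot all_order all_algebra.
From mathcomp Require Import all_classical all_reals all_analysis.

Set Implicit Arguments.
Unset Strict Implicit.
Unset Printing Implicit Defensive.

Import Order.TTheory GRing.Theory Num.Theory.
Import numFieldNormedType.Exports.

Local Open Scope classical_set_scope.
Local Open Scope ring_scope.

(* V_n is 'I_n (vertices numbered from 0), E_n is the finite type [edge n], and
   R^{E_n} is realised as row vectors indexed by E_n through [enum_rank]; this
   gives it the library's linear structure and topology. *)
Notation edge n := {e : {set 'I_n} | #|e| == 2%N}.
Notation evec R n := 'rV[R]_#|{: edge n}|.

Section Polyhedra.
Context {R : realType} {d : nat}.
Implicit Types (x y c : 'rV[R]_d) (A F Q : set 'rV[R]_d).
Implicit Types C D : set (set 'rV[R]_d).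

Definition dot x y : R := \sum_i x 0 i * y 0 i.

Definition convex_hull A : set 'rV[R]_d :=
  [set x | exists k (p : 'I_k -> 'rV[R]_d) (w : 'I_k -> R),
    [/\ forall i, A (p i), forall i, 0 <= w i, \sum_i w i = 1
      & x = \sum_i w i *: p i]].

Definition affine_hull A : set 'rV[R]_d :=
  [set x | exists k (p : 'I_k -> 'rV[R]_d) (w : 'I_k -> R),
    [/\ forall i, A (p i), \sum_i w i = 1 & x = \sum_i w i *: p i]].

Definition relint A : set 'rV[R]_d :=
  [set x | A x /\ \forall y \near x, affine_hull A y -> A y].

Definition polyhedron Q : Prop :=
  exists k (c : 'I_k -> 'rV[R]_d) (g : 'I_k -> R),
    Q = [set x | forall i, g i <= dot (c i) x].

Definition valid Q c (g : R) : Prop := forall x, Q x -> g <= dot c x.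

(* Both the empty set (c = 0, g < 0) and Q itself (c = 0, g = 0) are faces. *)
Definition face Q F : Prop :=
  exists c (g : R), valid Q c g /\ F = [set x | Q x /\ dot c x = g].

Definition vertex Q x : Prop := face Q [set x].

(* The empty polyhedron is disregarded: a complex need not contain it, whereas
   two members may have empty intersection. *)
Definition polyhedral_complex C : Prop :=
  [/\ finite_set C,
      forall F, C F -> polyhedron F,
      forall F G, C F -> face F G -> G !=set0 -> C G
    & forall F G, C F -> C G -> face F (F `&` G) /\ face G (F `&` G)].

Definition eq_complex C D : Prop := C `\ set0 = D `\ set0.

Definition support_of C : set 'rV[R]_d := \bigcup_(F in C) F.

Definition refinement C D : set (set 'rV[R]_d) :=
  [set H | exists F G, [/\ C F, D G & H = F `&` G]].

End Polyhedra.

Section Graphs.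
Context {R : realType} {n : nat}.
Implicit Types (a b d q x : evec R n) (u v w : 'I_n) (e : edge n).

Definition coord x e : R := x 0 (enum_rank e).

(* x_{uv} for u != v; the value 0 at u = v is a dummy. *)
Definition entry x u v : R := oapp (coord x) 0 (insub [set u; v]%SET).

Definition chi (F : {set edge n}) : evec R n := \row_i ((enum_val i : edge n) \in F)%:R.

(* A cycle with vertex set V_n is given by a cyclic listing of the vertices. *)
Definition hamilton (s : seq 'I_n) : bool := uniq s && [forall u, u \in s].

Definition cycle_edges (s : seq 'I_n) : {set edge n} :=
  [set e : edge n | [exists u, val e == [set u; next s u]%SET]]%SET.

Definition STSP : set (evec R n) :=
  convex_hull [set x | exists s, hamilton s /\ x = chi (cycle_edges s)].

(* [m e] is the number of copies of the edge e in a multigraph on V_n. *)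
Definition connected_mg (m : edge n -> nat) : bool :=
  [forall u, forall v,
    connect [rel u1 u2 | [exists e : edge n,
                            (val e == [set u1; u2]%SET) && (0 < m e)%N]] u v].

Definition eulerian_mg (m : edge n -> nat) : bool :=
  [forall u, ~~ odd (\sum_(e : edge n | u \in val e) m e)%N].

Definition GTSP : set (evec R n) :=
  convex_hull [set x | exists m : edge n -> nat,
    [/\ connected_mg m, eulerian_mg m & forall e, coord x e = (m e)%:R]].

Definition delta u : evec R n :=
  \row_i (if u \in val (enum_val i : edge n) then 2^-1 else 0).

Definition L : set (evec R n) := [set x | forall u, dot (delta u) x = 0].

Definition Lperp : set (evec R n) := [set q | forall x, L x -> dot q x = 0].

Definition projL x : evec R n := xget 0 [set y | L y /\ Lperp (x - y)].

Definition z : evec R n := const_mx (2 / n.-1%:R).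

Definition polarS : set (evec R n) :=
  [set a | L a /\ forall x, STSP x -> dot (- a) (x - z) <= 1].

Definition N : set (evec R n) :=
  [set a | vertex polarS a /\ exists e,
    [set x | STSP x /\ dot a x = dot a z - 1]
    = [set x | STSP x /\ coord x e = 0]].

Definition dlN : set (set (evec R n)) :=
  [set F | face polarS F /\ F `&` N = set0].

Definition rotF a : set (set (evec R n)) :=
  [set F | face GTSP F /\ exists q, [/\ Lperp q,
     valid GTSP (a + q) (dot a z - 1 + dot q z)
   & F = [set x | GTSP x /\ dot (a + q) x = dot a z - 1 + dot q z]]].

Definition rot_cells : set (set (evec R n)) :=
  [set [set b | support_of dlN b /\ rotF b = rotF a] | a in support_of dlN].

Definition rot_complex : set (set (evec R n)) :=
  [set closure X | X in rot_cells].

Definition tri u v w a : R := entry a v u + entry a u w - entry a v w.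

Definition distinct3 u v w : Prop := [/\ u <> v, u <> w & v <> w].

Definition metric_cone : set (evec R n) :=
  [set d | forall u v w, distinct3 u v w -> 0 <= tri u v w d].

Definition tri_face u v w : set (evec R n) :=
  [set d | metric_cone d /\ tri u v w d = 0].

Definition tt_faces : set (set (evec R n)) :=
  \bigcap_(u in [set: 'I_n])
    [set F | exists v w, distinct3 u v w /\ face (tri_face u v w) F].

Definition flat_TT_fan : set (set (evec R n)) :=
  [set projL @` F | F in tt_faces].

(* For n >= 3 the infimum is over a finite nonempty set, hence a minimum. *)
Definition tmin u a : R :=
  inf [set r | exists v w, distinct3 u v w /\ r = tri u v w a].

Definition Eu u a : set (edge n) :=
  [set e | exists v w,
    [/\ distinct3 u v w, val e = [set v; w]%SET & tri u v w a = tmin u a]].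

End Graphs.

Arguments STSP : clear implicits.
Arguments GTSP : clear implicits.
Arguments polarS : clear implicits.
Arguments N : clear implicits.
Arguments dlN : clear implicits.
Arguments rot_cells : clear implicits.
Arguments rot_complex : clear implicits.
Arguments flat_TT_fan : clear implicits.

(* Main.v *)
From mathcomp Require Import all_boot all_order all_algebra.
From mathcomp Require Import all_classical all_reals all_analysis.
From mathcomp Require Import ring lra.
Require Import Defs.
Import Order.TTheory GRing.Theory Num.Theory.
Import numFieldNormedType.Exports.
Local Open Scope classical_set_scope.
Local Open Scope ring_scope.

Set Implicit Arguments.
Unset Strict Implicit.
Unset Printing Implicit Defensive.

(** The rotation complex has a purely combinatorial description, from which all
    claims follow.

    Attach to a point a of the polar two finite sets: its tight tours, i.e. the
    Hamilton cycles on which the inequality a.x >= a.z - 1 is tight, and its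
    minimal triples (u, v, w), i.e. those for which the triangle slack
    t_{u,vw}(a) is minimal among all slacks at u.  The tight tours determine the
    face of the polar with a in its relative interior.  The minimal triples
    determine the cone of the flat TT-fan with a in its relative interior: adding
    node weights (elements of Lperp) shifts all slacks at u by the same amount, and
    the smallest shift of a into the metric cone, tt_form a, has minimal slack 0 at
    each vertex, so that its vanishing slacks are the minimal ones of a.

    The heart of the matter is rotF_eq: two points of |dl(N, polar)| have the same
    set of rotated faces if and only if they have the same tight tours and the same
    minimal triples.  First, for a in |dl(N, polar)| a rotated inequality a + q is
    valid for the graphical polyhedron if and only if a + q is in the metric cone.
    It is sufficient because an Euler tour of a connected Eulerian multigraph can
    be shortcut to a Hamilton cycle (euler_tour, cost_shortcut,
    metric_valid_GTSP).  It is necessary because each edge vw lies in a tight tour,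
    and replacing vw by the path v, u, w yields a point of the graphical polyhedron
    whose slack is t_{u,vw}(a + q) (detour, rotation_metric).  That each edge lies
    in a tight tour is where N enters: the vertices of N are given by the
    inequalities x_e >= 0, and these define facets because the Hamilton cycles that
    avoid a fixed edge span enough directions (rigidity, from comparing pairs of
    cycles that differ in four edges).  Second, the face exposed by tt_form a
    contains the tight tours of a and the detours of minimal triples, hence
    determines both sets (rotF_inj).  Conversely, if a and b have the same two sets
    then a rotation of b with the same slacks at each vertex exposes the same face,
    by perturbing one inequality by a small multiple of the other (tight_transfer).

    Hence the cells are the sets on which both finite sets are constant.  Once the
    minimal triples contain a fixed set with a triple at each vertex, both sets
    record active inequalities of one linear system, and general facts about
    polyhedra identify closures, relative interiors, faces and intersections of
    cells (closure_active, relint_sys_face, face_sys_face, ex_least_active). *)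

(** * Linear functionals and small perturbations *)

Section Dot.
Context {R : realType} {d : nat}.
Implicit Types (x y c : 'rV[R]_d).

Lemma dotC x y : dot x y = dot y x.
Proof. by apply: eq_bigr => i _; rewrite mulrC. Qed.

Lemma dotDr c x y : dot c (x + y) = dot c x + dot c y.
Proof. by rewrite /dot -big_split; apply: eq_bigr => i _; rewrite !mxE mulrDr. Qed.

Lemma dotZr c a x : dot c (a *: x) = a * dot c x.
Proof. by rewrite /dot big_distrr; apply: eq_bigr => i _; rewrite !mxE /= mulrCA. Qed.

Lemma dotNr c x : dot c (- x) = - dot c x.
Proof. by rewrite -scaleN1r dotZr mulN1r. Qed.

Lemma dotBr c x y : dot c (x - y) = dot c x - dot c y.
Proof. by rewrite dotDr dotNr. Qed.

Lemma dot0r c : dot c 0 = 0.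
Proof. by rewrite -(scale0r 0) dotZr mul0r. Qed.

Lemma dot_sumr c (I : Type) (r : seq I) (P : pred I) (F : I -> 'rV_d) :
  dot c (\sum_(i <- r | P i) F i) = \sum_(i <- r | P i) dot c (F i).
Proof. exact: (big_morph (dot c) (dotDr c) (dot0r c)). Qed.

Lemma dotDl x y c : dot (x + y) c = dot x c + dot y c.
Proof. by rewrite !(dotC _ c) dotDr. Qed.

Lemma dotZl a x c : dot (a *: x) c = a * dot x c.
Proof. by rewrite !(dotC _ c) dotZr. Qed.

Lemma dotNl x c : dot (- x) c = - dot x c.
Proof. by rewrite !(dotC _ c) dotNr. Qed.

Lemma dotBl x y c : dot (x - y) c = dot x c - dot y c.
Proof. by rewrite !(dotC _ c) dotBr. Qed.

Lemma dot0l c : dot 0 c = 0.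
Proof. by rewrite dotC dot0r. Qed.

Lemma dot_suml c (I : Type) (r : seq I) (P : pred I) (F : I -> 'rV_d) :
  dot (\sum_(i <- r | P i) F i) c = \sum_(i <- r | P i) dot (F i) c.
Proof. by rewrite dotC dot_sumr; apply: eq_bigr => i _; rewrite dotC. Qed.

Lemma dot_eq0 x : dot x x = 0 -> x = 0.
Proof.
move=> /eqP; rewrite psumr_eq0 => [/allP h|i _]; last by rewrite -expr2 sqr_ge0.
apply/rowP => i; rewrite mxE; apply/eqP.
by have := h i (mem_index_enum i); rewrite mulf_eq0 orbb.
Qed.

Lemma dot_continuous c : continuous (dot c).
Proof.
have addc : continuous (fun p : R * R => p.1 + p.2) by exact: add_continuous.
apply: (@continuous_big _ _ _ 0 xpredT addc _ _ (fun i x => c 0 i * x 0 i)) => i _ x.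
exact: (continuousM (@cst_continuous _ _ (c 0 i) x) (@coord_continuous R 1 d 0 i x)).
Qed.

Lemma convex_hull_valid (A : set 'rV[R]_d) c g :
  valid A c g -> valid (convex_hull A) c g.
Proof.
move=> v x [k [p [w [Ap w0 w1 ->]]]]; rewrite dot_sumr -[g]mul1r -w1 mulr_suml.
by apply: ler_sum => i _; rewrite dotZr; apply: ler_wpM2l => //; exact: v.
Qed.

Lemma convex_hull_sub (A : set 'rV[R]_d) : A `<=` convex_hull A.
Proof.
move=> x Ax; exists 1, (fun=> x), (fun=> 1); split => //.
- by rewrite big_ord1.
- by rewrite big_ord1 scale1r.
Qed.

End Dot.

(** Every single condition holds for all small enough positive e: if A i > 0
    take e below A i / B i, and if A i = 0 then B i is not positive.  Being
    finitely many, the conditions hold simultaneously. *)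
Lemma ex_small_multiplier (R : realType) (I : finType) (A B : I -> R) :
  (forall i, 0 <= A i) -> (forall i, A i = 0 -> B i <= 0) ->
  exists e, 0 < e /\ forall i, e * B i <= A i.
Proof.
move=> A0 AB.
suff [e [e0 h]] : exists e, 0 < e /\ forall i, i \in enum I -> e * B i <= A i.
  by exists e; split => // i; apply: h; rewrite mem_enum.
elim: (enum I) => [|j s [e [e0 h]]]; first by exists 1.
have [f [f0 hf]] : exists f, 0 < f /\ f * B j <= A j.
  have [B0|B0] := leP (B j) 0.
    by exists 1; split => //; rewrite mul1r (le_trans B0).
  exists (A j / B j); rewrite divfK ?gt_eqF //; split => //.
  rewrite divr_gt0 // lt_neqAle A0 andbT eq_sym; apply/eqP => /AB.
  by rewrite leNgt B0.
exists (Num.min e f); split; first by rewrite lt_min e0 f0.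
move=> i; rewrite inE.
have key g : 0 < g -> Num.min e f <= g -> g * B i <= A i ->
    Num.min e f * B i <= A i.
  move=> g0 hg hB; have [B0|B0] := leP (B i) 0.
    by apply: le_trans (A0 i); apply: mulr_ge0_le0 => //; rewrite le_min !ltW.
  by apply: le_trans hB; apply: ler_wpM2r => //; exact: ltW.
case/orP => [/eqP ij|/h]; last by apply: key; rewrite // ge_min lexx.
by move: hf; rewrite -ij; apply: key; rewrite // ge_min lexx orbT.
Qed.

Lemma ex_minimizer (T : Type) (F : set T) (h : T -> nat) :
  F !=set0 -> exists x, F x /\ forall y, F y -> (h x <= h y)%N.
Proof.
move=> [x0 Fx0].
have ex : exists n, `[< exists x, F x /\ h x = n >].
  by exists (h x0); apply/asboolP; exists x0.
case: (ex_minnP ex) => n /asboolP [x [Fx hx]] hmin.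
exists x; split => // y Fy; rewrite hx; apply: hmin.
by apply/asboolP; exists y.
Qed.

(** * Polyhedra given by finite systems of inequalities *)

Section Systems.
Context {R : realType} {d : nat} {I : finType}.
Variables (c : I -> 'rV[R]_d) (g : I -> R).
Implicit Types (x y : 'rV[R]_d) (J K : {set I}).

Definition solutions : set 'rV[R]_d := [set x | forall i, g i <= dot (c i) x].

Definition active x : {set I} := [set i | dot (c i) x == g i]%SET.

(** Faces are encoded by the inequalities that they turn into equations, so that
    questions about faces become questions about finite index sets. *)
Definition sys_face J : set 'rV[R]_d :=
  [set x | solutions x /\ J \subset active x].

Lemma polyhedron_fin (I' : finType) (c' : I' -> 'rV[R]_d) (g' : I' -> R) :
  polyhedron [set x | forall i, g' i <= dot (c' i) x].
Proof.
exists #|I'|, (fun i => c' (enum_val i)), (fun i => g' (enum_val i)).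
apply/seteqP; split => x /= h i; first exact: h.
by have := h (enum_rank i); rewrite enum_rankK.
Qed.

Lemma sys_face_polyhedron J : polyhedron (sys_face J).
Proof.
suff -> : sys_face J = [set x | forall p : I * bool,
    (if p.2 then g p.1 else if p.1 \in J then - g p.1 else 0) <=
    dot (if p.2 then c p.1 else if p.1 \in J then - c p.1 else 0) x].
  exact: (polyhedron_fin (fun p : I * bool => if p.2 then c p.1 else _)).
apply/seteqP; split => x /=.
  move=> [sx /fintype.subsetP Jx] [i []] //=; case: ifP => [/Jx|_]; last by rewrite dot0l.
  by rewrite inE dotNl => /eqP ->.
move=> h; split => [i|]; first exact: (h (i, true)).
apply/fintype.subsetP => i iJ; rewrite inE eq_le (h (i, true)) andbT.
by have := h (i, false); rewrite /= iJ dotNl lerN2.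
Qed.

(** The sum of the inequalities in K is valid, and it is tight exactly where each
    of its summands is. *)
Lemma sys_face_face J K : J \subset K -> face (sys_face J) (sys_face K).
Proof.
move=> JK; exists (\sum_(i in K) c i), (\sum_(i in K) g i); split.
  by move=> x [sx _]; rewrite dot_suml; apply: ler_sum => i _; exact: sx.
apply/seteqP; split => x /=.
  move=> [sx Kx]; split; first by split => //; exact: fintype.subset_trans Kx.
  rewrite dot_suml; apply: eq_bigr => i iK.
  by have := fintype.subsetP Kx i iK; rewrite inE => /eqP.
move=> [[sx Jx] e]; split => //; apply/fintype.subsetP => i iK; rewrite inE.
have : \sum_(j in K) (dot (c j) x - g j) == 0.
  by rewrite sumrB -e dot_suml subrr.
rewrite psumr_eq0 => [/allP h|j _]; last by rewrite subr_ge0 sx.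
by have := h i (mem_index_enum _); rewrite iK subr_eq0.
Qed.

(** The inequalities that are tight at x stay tight along the line through x and
    y, and the others leave room for a short step beyond x. *)
Lemma extrapolate x y : solutions x -> solutions y -> active x \subset active y ->
  exists e, 0 < e /\ solutions (x + e *: (x - y)).
Proof.
move=> sx sy xy.
have [||e [e0 he]] := @ex_small_multiplier R I (fun i => dot (c i) x - g i)
    (fun i => dot (c i) y - dot (c i) x).
- by move=> i; rewrite subr_ge0.
- move=> i /eqP; rewrite subr_eq0 => h.
  have : i \in active y by apply: (fintype.subsetP xy); rewrite inE.
  by rewrite inE (eqP h) => /eqP ->; rewrite subrr.
exists e; split => // i; have := he i; rewrite dotDr dotZr dotBr.
by move=> h; lra.
Qed.

Lemma active_comb J x y e : J \subset active x -> J \subset active y ->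
  J \subset active (x + e *: (x - y)).
Proof.
move=> /fintype.subsetP Jx /fintype.subsetP Jy; apply/fintype.subsetP => i iJ.
have := Jx i iJ; have := Jy i iJ; rewrite !inE dotDr dotZr dotBr => /eqP -> /eqP ->.
by rewrite subrr mulr0 addr0.
Qed.

(** A functional that attains its minimum at x cannot decrease from x towards y;
    as the segment can be prolonged beyond x, it cannot increase either. *)
Lemma face_active J F x : face (sys_face J) F -> F x ->
  sys_face (active x) `<=` F.
Proof.
move=> [h [b [hv ->]]] [[sx Jx] hx] y [sy xy].
have Jy := fintype.subset_trans Jx xy; split => //=.
have [e [e0 se]] := extrapolate sx sy xy.
have := hv _ (conj se (active_comb e Jx Jy)).
rewrite dotDr dotZr dotBr hx => H.
have := hv y (conj sy Jy) => H1; apply/le_anti; rewrite H1 andbT.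
by move: H; rewrite lerDl pmulr_rge0 // subr_ge0.
Qed.

Definition midpoint x y : 'rV[R]_d := 2^-1 *: (x + y).

Lemma dot_mid h x y : dot h (midpoint x y) = (dot h x + dot h y) / 2.
Proof. by rewrite dotZr dotDr mulrC. Qed.

Lemma solutions_mid x y : solutions x -> solutions y -> solutions (midpoint x y).
Proof. by move=> sx sy i; rewrite dot_mid; have := sx i; have := sy i; lra. Qed.

Lemma active_mid x y : solutions x -> solutions y ->
  active (midpoint x y) = active x :&: active y.
Proof.
move=> sx sy; apply/finset.setP => i; rewrite !inE dot_mid.
have := sx i; have := sy i => hy hx.
apply/idP/andP => [/eqP h|[/eqP -> /eqP ->]]; last by apply/eqP; lra.
by split; apply/eqP; lra.
Qed.

(** The active set of a midpoint is the intersection of the active sets of the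
    end points, so a point with the fewest active inequalities has the least
    active set. *)
Lemma ex_least_active (F : set 'rV[R]_d) : F `<=` solutions -> F !=set0 ->
  (forall x y, F x -> F y -> F (midpoint x y)) ->
  exists x, F x /\ forall y, F y -> active x \subset active y.
Proof.
move=> Fs F0 Fm; have [x [Fx hx]] := ex_minimizer (fun x => #|active x|) F0.
exists x; split => // y Fy.
have := hx _ (Fm _ _ Fx Fy); rewrite active_mid; [|exact: Fs..].
move=> h; apply/finset.setIidPl/eqP.
by rewrite eqEcard finset.subsetIl.
Qed.

(** The active set of a relative interior point determines the face. *)
Lemma face_sys_face J F : face (sys_face J) F -> F !=set0 ->
  exists x, F x /\ F = sys_face (active x).
Proof.
move=> fF F0; have [h [b [hv eF]]] := fF.
have [||x [Fx hx]] := ex_least_active _ F0.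
- by rewrite eF => x [[]].
- rewrite eF => x y [[sx Jx] hx] [[sy Jy] hy]; split; first split.
  + exact: solutions_mid.
  + by rewrite active_mid // finset.subsetI Jx Jy.
  + by rewrite dot_mid hx hy; lra.
exists x; split => //; apply/seteqP; split; last exact: face_active fF Fx.
by move=> y Fy; split; [move: Fy; rewrite eF => -[[]] | exact: hx].
Qed.

(** Neighbourhoods are only used through the points that they contain on a segment
    issuing from their centre. *)
Lemma near_segment x v (A : set 'rV[R]_d) :
  nbhs x A -> exists e, [/\ 0 < e, e <= 1 & A (x + e *: v)].
Proof.
move=> nA.
have cv : (fun e : R => x + e *: v) @ 0^'+ --> x.
  have : (fun e : R => x + e *: v) @ 0^'+ --> x + (0 : R) *: v.
    apply: cvgD; first exact: cvg_cst.
    apply: (@cvg_trans _ ((fun e : R => e *: v) @ nbhs (0:R))).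
      by apply: cvg_app; apply: cvg_within.
    exact: scalel_continuous.
  by rewrite scale0r addr0.
have H : \forall e \near 0^'+, A (x + e *: v) by exact: (cv _ nA).
near (0:R)^'+ => e; exists e; split.
- by near: e; exact: nbhs_right_gt.
- by near: e; apply: nbhs_right_le.
- by near: e.
Unshelve. all: by end_near. Qed.

(** Inequalities that are not active at x stay strict nearby, whereas the affine
    hull of the face satisfies the active ones with equality.  Conversely, a
    relative interior point y can be pushed slightly away from x inside the face,
    which would violate any inequality active at y but not at x. *)
Lemma relint_sys_face x : solutions x ->
  relint (sys_face (active x)) = [set y | solutions y /\ active y = active x].
Proof.
move=> sx; apply/seteqP; split => y /=.
  move=> [[sy xy] nearA]; split => //; apply/eqP; rewrite finset.eqEsubset xy andbT.
  have [e [e0 e1 he]] := near_segment (y - x) nearA.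
  have aff : affine_hull (sys_face (active x)) (y + e *: (y - x)).
    exists 2, (fun i : 'I_2 => if val i == 0 then y else x),
      (fun i : 'I_2 => if val i == 0 then 1 + e else - e); split.
    - by move=> i; case: ifP.
    - by rewrite !big_ord_recl big_ord0 /=; lra.
    - rewrite !big_ord_recl big_ord0 /= scalerDl scale1r scaleNr addr0 scalerBr.
      by rewrite addrA.
  have [se _] := he aff.
  apply/fintype.subsetP => i; rewrite !inE => /eqP hy.
  have := se i; rewrite dotDr dotZr dotBr hy lerDl pmulr_rge0 // subr_ge0 => hx.
  by rewrite eq_le hx; exact: sx.
move=> [sy yx]; split; first by split => //; rewrite yx.
have nin : \forall w \near y, forall i, i \notin active x -> g i < dot (c i) w.
  apply: (@filter_forall _ I
    (fun i w => i \notin active x -> g i < dot (c i) w) (nbhs y)) => i.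
  have [ix|ix] := boolP (i \in active x); first by apply: nearW => w /negP.
  have : g i < dot (c i) y.
    by rewrite lt_neqAle sy andbT; move: ix; rewrite -yx inE eq_sym.
  move=> h; have h' : \forall w \near y, g i < dot (c i) w.
    exact: (cvgr_gt _ (@dot_continuous R d (c i) y) _ h).
  by move: h'; apply: filterS => w hw _.
near=> w; move=> [k [p [wt [hp w1 ew]]]].
have act i : i \in active x -> dot (c i) w = g i.
  move=> ix; rewrite ew dot_sumr -[RHS]mul1r -w1 mulr_suml; apply: eq_bigr => j _.
  rewrite dotZr; have [_ /fintype.subsetP /(_ i ix)] := hp j.
  by rewrite inE => /eqP ->.
split; last by apply/fintype.subsetP => i /act h; rewrite inE h.
move=> i; have [/act -> //|ix] := boolP (i \in active x).
by apply: ltW; move: i ix; near: w.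
Unshelve. all: by end_near. Qed.

Lemma closed_sys_face J : closed (sys_face J).
Proof.
suff -> : sys_face J = \bigcap_(i in [set: I])
   (dot (c i) @^-1` [set t | g i <= t]) `&`
  \bigcap_(i in [set` J]) (dot (c i) @^-1` [set t | t = g i]).
  apply: closedI; apply: closed_bigI => i _; apply: preimage_closed.
  - by move=> ? _; exact: dot_continuous.
  - exact: closed_ge.
  - by move=> ? _; exact: dot_continuous.
  - exact: closed_eq.
apply/seteqP; split => x /=.
  move=> [sx /fintype.subsetP Jx]; split => i //= iJ.
  by have := Jx i iJ; rewrite inE => /eqP.
move=> [h1 h2]; split => [i|]; first exact: (h1 i).
by apply/fintype.subsetP => i iJ; rewrite inE; apply/eqP; exact: (h2 i).
Qed.

(** Every point of the face is a limit of points on the segment to x, and these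
    have the same active inequalities as x. *)
Lemma closure_active x : solutions x ->
  closure [set y | solutions y /\ active y = active x] = sys_face (active x).
Proof.
move=> sx; apply/seteqP; split.
  rewrite [X in _ `<=` X](closure_id _).1; last exact: closed_sys_face.
  by apply: closure_subset => y [sy yx]; split => //; rewrite yx.
move=> y [sy xy] A /(near_segment (x - y)) [e [e0 e1 Ae]].
exists (y + e *: (x - y)); split => //.
have hd i : dot (c i) (y + e *: (x - y)) - g i =
    (1 - e) * (dot (c i) y - g i) + e * (dot (c i) x - g i).
  by rewrite dotDr dotZr dotBr; ring.
have ty i : 0 <= (1 - e) * (dot (c i) y - g i).
  by rewrite mulr_ge0 // subr_ge0 //; exact: sy.
have tx i : 0 <= dot (c i) x - g i by rewrite subr_ge0; exact: sx.
split=> [i|].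
  by rewrite -subr_ge0 hd addr_ge0 // mulr_ge0 // ltW.
apply/finset.setP => i; rewrite !inE -subr_eq0 hd paddr_eq0 //; last first.
  by rewrite mulr_ge0 // ltW.
rewrite [X in _ && X]mulf_eq0 (gt_eqF e0) /= subr_eq0 andbC.
apply/andP/idP => [[]//|h]; split => //.
have : i \in active y by apply: (fintype.subsetP xy); rewrite inE.
by rewrite inE -subr_eq0 => /eqP ->; rewrite mulr0.
Qed.

End Systems.


(** * Edges and edge-indexed vectors *)

Section Edges.
Context {n : nat}.
Implicit Types (u v w : 'I_n) (e : edge n).

Lemma edge_of u v : u != v -> exists e, val e = [set u; v]%SET.
Proof.
move=> uv; have uv2 : #|[set u; v]%SET| == 2%N by rewrite cards2 uv.
by exists (exist (fun e : {set _} => #|e| == 2%N) _ uv2).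
Qed.

Lemma edge_ends e u : u \in val e -> exists v, u != v /\ val e = [set u; v]%SET.
Proof.
move=> ue; have /cards2P [x [y [xy exy]]] := valP e.
move: ue; rewrite exy !inE => /orP [] /eqP ->; [exists y | exists x]; split => //.
  by rewrite eq_sym.
by rewrite finset.setUC.
Qed.

Lemma edge_pair e : exists u v, u != v /\ val e = [set u; v]%SET.
Proof. by have /cards2P [x [y [xy exy]]] := valP e; exists x, y. Qed.

Lemma edge_neq e u v : val e = [set u; v]%SET -> u != v.
Proof. by move=> h; have := valP e; rewrite h cards2; case: (u != v). Qed.

Lemma edge_diag e u : (val e == [set u; u]%SET) = false.
Proof. by apply/eqP => /edge_neq; rewrite eqxx. Qed.

Lemma set2_inj u v w : [set u; v]%SET = [set u; w]%SET -> v = w.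
Proof.
move=> h; have : v \in [set u; w]%SET by rewrite -h !inE eqxx orbT.
have : w \in [set u; v]%SET by rewrite h !inE eqxx orbT.
by rewrite !inE => /orP [] /eqP -> // /orP [] /eqP.
Qed.

Lemma sum_edge_eq (T : nmodType) (F : edge n -> T) e :
  \sum_e' (if val e' == val e then F e' else 0) = F e.
Proof.
rewrite (bigD1 e) //= eqxx big1 ?addr0 // => f fe.
by rewrite (inj_eq val_inj) (negbTE fe).
Qed.

End Edges.

Section Coordinates.
Context {R : realType} {n : nat}.
Implicit Types (u v w : 'I_n) (e : edge n) (x y c : evec R n).

Lemma dot_coord x y : dot x y = \sum_e coord x e * coord y e.
Proof.
rewrite /dot (reindex (enum_rank : edge n -> _)) //=.
by exists enum_val => ? _; rewrite ?enum_rankK ?enum_valK.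
Qed.

Lemma coord_ext x y : (forall e, coord x e = coord y e) -> x = y.
Proof. by move=> h; apply/rowP => i; have := h (enum_val i);
  rewrite /coord enum_valK. Qed.

Lemma entry_coord x u v e : val e = [set u; v]%SET -> entry x u v = coord x e.
Proof. by move=> h; rewrite /entry -h valK. Qed.

Lemma entry_diag x u : entry x u u = 0.
Proof. by rewrite /entry insubF //= cards2 eqxx. Qed.

Lemma entryC x u v : entry x u v = entry x v u.
Proof. by rewrite /entry finset.setUC. Qed.

Lemma entry_sum x u v :
  entry x u v = \sum_e (if val e == [set u; v]%SET then coord x e else 0).
Proof.
have [->|/edge_of [e he]] := eqVneq u v.
  by rewrite entry_diag big1 // => e _; rewrite edge_diag.
by rewrite (entry_coord _ he) -he sum_edge_eq.
Qed.

(** The functional that reads the entry at u, v; it is 0 for u = v. *)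
Definition pair_vec u v : evec R n :=
  \row_i (val (enum_val i : edge n) == [set u; v]%SET)%:R.

Lemma coord_row (F : edge n -> R) e : coord (\row_i F (enum_val i)) e = F e.
Proof. by rewrite /coord mxE enum_rankK. Qed.

Lemma entry_dot x u v : entry x u v = dot (pair_vec u v) x.
Proof.
rewrite entry_sum dot_coord; apply: eq_bigr => e _.
rewrite (coord_row (fun e => (val e == [set u; v]%SET)%:R)).
by case: ifP; rewrite ?mul1r ?mul0r.
Qed.

Lemma entryZ a x u v : entry (a *: x) u v = a * entry x u v.
Proof. by rewrite !entry_dot dotZr. Qed.

Lemma entry_sumr (I : Type) (r : seq I) (P : pred I) (F : I -> evec R n) u v :
  entry (\sum_(i <- r | P i) F i) u v = \sum_(i <- r | P i) entry (F i) u v.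
Proof. by rewrite entry_dot dot_sumr; apply: eq_bigr => i _; rewrite entry_dot. Qed.

Lemma entry_ext x y : (forall u v, u != v -> entry x u v = entry y u v) -> x = y.
Proof.
move=> h; apply: coord_ext => e; have [u [v [uv euv]]] := edge_pair e.
by rewrite -!(entry_coord _ euv) h.
Qed.

Lemma dot_delta u x : dot (delta u) x = 2^-1 * \sum_v entry x u v.
Proof.
rewrite dot_coord; under [in RHS]eq_bigr do rewrite entry_sum.
rewrite exchange_big mulr_sumr /=; apply: eq_bigr => e _.
rewrite (coord_row (fun e => if u \in val e then 2^-1 else 0)).
case: ifPn => [/edge_ends [w [uw ew]]|ue].
  congr (_ * _); rewrite (bigD1 w) //= ew eqxx big1 ?addr0 // => v vw.
  by case: eqP => // /set2_inj h; rewrite h eqxx in vw.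
rewrite mul0r big1 ?mulr0 // => v _; case: eqP => // h.
by move: ue; rewrite [val e]h !inE eqxx.
Qed.

Lemma entry_delta (w u v : 'I_n) : u != v ->
  entry (delta w : evec R n) u v = 2^-1 * ((w == u)%:R + (w == v)%:R).
Proof.
move=> uv; have [e he] := edge_of uv; rewrite (entry_coord _ he).
rewrite (coord_row (fun e => if w \in val e then 2^-1 else 0)) he !inE.
have [->|_] := eqVneq w u; last by case: (w == v); rewrite /= ?add0r ?mulr1 ?mulr0.
by rewrite (negbTE uv) /= addr0 mulr1.
Qed.

(** The elements of Lperp, written as node weights; see LperpP. *)
Definition potential (l : 'I_n -> R) : evec R n := \sum_u l u *: delta u.

Lemma entry_potential l u v : u != v -> entry (potential l) u v = (l u + l v) / 2.
Proof.
move=> uv; rewrite entry_sumr (bigD1 u) //= (bigD1 v) //= 1?eq_sym //.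
rewrite !entryZ !entry_delta // !eqxx (negbTE uv) eq_sym (negbTE uv).
rewrite big1 => [|w /andP [wu wv]]; first by rewrite !(mulr1n, mulr0n, addr0, add0r,
  mulr1) mulrDl.
by rewrite entryZ entry_delta // (negbTE wu) (negbTE wv) addr0 !mulr0.
Qed.

(** The reason why Lperp controls triangle slacks: node weights shift all slacks
    at u by the same amount, and they do so independently for each u. *)
Lemma tri_potential l u v w : distinct3 u v w -> tri u v w (potential l) = l u.
Proof.
move=> [/eqP uv /eqP uw /eqP vw].
by rewrite /tri !entry_potential // 1?eq_sym //; lra.
Qed.

Lemma dot_potential l x : dot (potential l) x = \sum_u l u * dot (delta u) x.
Proof. by rewrite dot_suml; apply: eq_bigr => u _; rewrite dotZl. Qed.

Definition tri_vec u v w : evec R n := pair_vec v u + pair_vec u w - pair_vec v w.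

Lemma tri_dot u v w x : tri u v w x = dot (tri_vec u v w) x.
Proof. by rewrite /tri dotBl dotDl !entry_dot. Qed.

Lemma triC u v w x : tri u v w x = tri u w v x.
Proof.
by rewrite /tri (entryC x w u) (entryC x w v) (entryC x u v) (addrC (entry x u w)).
Qed.

Lemma ex_third (u v : 'I_n) : (2 < n)%N -> exists w, (w != u) && (w != v).
Proof.
move=> n3; apply/existsP; apply: contraT => /existsPn h.
have : [set: 'I_n]%SET \subset [set u; v]%SET.
  by apply/fintype.subsetP => w _; have := h w; rewrite negb_and !negbK !inE.
move=> /subset_leq_card; rewrite cardsT card_ord cards2 leqNgt.
by rewrite (leq_ltn_trans _ n3) //; case: (u != v).
Qed.

Lemma tri_sum c u v w : tri u v w c + tri v u w c = entry c u v *+ 2.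
Proof. by rewrite /tri (entryC c v u); ring. Qed.

(** With a third vertex available, twice an entry is the sum of two triangle
    slacks. *)
Lemma metric_nneg c u v : (2 < n)%N -> metric_cone c -> 0 <= entry c u v.
Proof.
move=> n3 mc; have [->|uv] := eqVneq u v; first by rewrite entry_diag.
have [w /andP [wu wv]] := ex_third u v n3.
have d1 : distinct3 u v w by split; apply/eqP; rewrite // eq_sym.
have d2 : distinct3 v u w by split; apply/eqP; rewrite // eq_sym.
by rewrite -(pmulrn_lge0 _ (ltn0Sn 1)) -(tri_sum c u v w) addr_ge0 //; apply: mc.
Qed.

Lemma metric_triangle c u v w : (2 < n)%N -> metric_cone c ->
  entry c u w <= entry c u v + entry c v w.
Proof.
move=> n3 mc.
have [->|uv] := eqVneq u v; first by rewrite entry_diag add0r.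
have [->|vw] := eqVneq v w; first by rewrite entry_diag addr0.
have [->|uw] := eqVneq u w.
  by rewrite entry_diag addr_ge0 // metric_nneg.
have := mc v u w; rewrite /tri subr_ge0; apply; split; apply/eqP => //.
by rewrite eq_sym.
Qed.

End Coordinates.

(** * Walks, Euler tours and shortcuts *)

Section Walks.
Context {n : nat}.
Implicit Types (u v w x y : 'I_n) (e : edge n) (p q s : seq 'I_n).

(** A walk is given by its first vertex x and the sequence p of the vertices visited
    after x; it is closed if [last x p = x]. *)
Definition steps x p := zip (belast x p) p.

Definition mult x p e : nat :=
  count (fun st : 'I_n * 'I_n => val e == [set st.1; st.2]%SET) (steps x p).

Definition moving : rel 'I_n := fun u v => u != v.

Lemma mult_cons x y p e :
  mult x (y :: p) e = ((val e == [set x; y]%SET) + mult y p e)%N.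
Proof. by []. Qed.

Lemma mult_cat x p q e : mult x (p ++ q) e = (mult x p e + mult (last x p) q e)%N.
Proof.
by rewrite /mult /steps belast_cat zip_cat ?size_belast // count_cat.
Qed.

Lemma mult_rcons x p y e :
  mult x (rcons p y) e = (mult x p e + (val e == [set last x p; y]%SET))%N.
Proof. by rewrite -cats1 mult_cat mult_cons /mult /= addn0. Qed.

Lemma sum_step u x y : x != y ->
  (\sum_(e : edge n | u \in val e) (val e == [set x; y]%SET) = (u == x) + (u == y))%N.
Proof.
move=> xy; have [e he] := edge_of xy.
rewrite big_mkcond (bigD1 e) //= he eqxx big1 ?addn0.
  rewrite !inE; have [->|ux] := eqVneq u x; last by case: (u == y).
  by rewrite (negbTE xy).
move=> f fe; case: ifP => // _; rewrite -he (inj_eq val_inj).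
by rewrite (negbTE fe).
Qed.

(** Each visit contributes two to the degree, except at the two ends. *)
Lemma odd_degree_walk u x p : path moving x p ->
  odd (\sum_(e : edge n | u \in val e) mult x p e)%N = (u == x) (+) (u == last x p).
Proof.
elim: p x => [|y p IH] x /=.
  by rewrite big1 // addbb.
move=> /andP [xy /IH h]; rewrite big_split oddD /= sum_step // oddD h.
by rewrite !oddb addbA -(addbA (u == x)) addbb addbF.
Qed.

Lemma size_walk x p : path moving x p -> size p = (\sum_(e : edge n) mult x p e)%N.
Proof.
elim: p x => [|y p IH] x /=; first by rewrite big1.
move=> /andP [xy /IH h]; rewrite big_split /= -h -add1n; congr addn.
have [e he] := edge_of xy.
by rewrite (bigD1 e) //= he eqxx big1 // => f fe; rewrite -he (inj_eq val_inj)
  (negbTE fe).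
Qed.

(** A walk that uses each edge at most as often as the multigraph m contains it. *)
Definition trail (m : edge n -> nat) x p : Prop :=
  path moving x p /\ forall e, (mult x p e <= m e)%N.

Lemma trail_extend m x p y e : trail m x p -> last x p != y ->
  val e = [set last x p; y]%SET -> (mult x p e < m e)%N -> trail m x (rcons p y).
Proof.
move=> [pp h] ly he hm; split; first by rewrite rcons_path pp.
move=> f; rewrite mult_rcons -he; have [|_] := eqVneq (val f) (val e);
  last by rewrite addn0.
by move=> /val_inj ->; rewrite addn1.
Qed.

Lemma trail_rot m x p y : trail m x p -> last x p = x -> y \in p ->
  exists q, [/\ trail m y q, last y q = y, size q = size p & mult y q =1 mult x p].
Proof.
move=> [pp h] lx yp; case/path.splitP: yp pp h lx => p1 p2 pp h lx.
exists (p2 ++ rcons p1 y).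
have lp2 : last y p2 = x by rewrite last_cat last_rcons in lx.
have hm : mult y (p2 ++ rcons p1 y) =1 mult x (rcons p1 y ++ p2).
  by move=> e; rewrite !mult_cat lp2 last_rcons addnC.
split => //.
- split=> [|e]; last by rewrite hm.
  by move: pp; rewrite !cat_path last_rcons lp2 => /andP [-> ->].
- by rewrite last_cat last_rcons.
- by rewrite !size_cat addnC.
Qed.

Lemma mult_mem x p e u : (0 < mult x p e)%N -> u \in val e -> u \in x :: p.
Proof.
elim: p x => [//|y p IH] x; rewrite mult_cons.
case: eqP => [-> _|_ h ue]; last by rewrite inE IH ?orbT.
by rewrite !inE => /orP [] ->; rewrite ?orbT.
Qed.

Lemma longest_trail m (x0 : 'I_n) : exists x p, trail m x p /\
  forall y q, trail m y q -> (size q <= size p)%N.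
Proof.
pose P k := `[< exists x p, trail m x p /\ size p = k >].
have ex : exists k, P k by exists 0%N; apply/asboolP; exists x0, [::].
have bd k : P k -> (k <= \sum_e m e)%N.
  move=> /asboolP [x [p [[pp h] <-]]].
  by rewrite (size_walk pp); apply: leq_sum => e _; exact: h.
case: (ex_maxnP ex bd) => k /asboolP [x [p [tp <-]]] hmax.
by exists x, p; split => // y q tq; apply: hmax; apply/asboolP; exists y, q.
Qed.

(** The half of Euler's theorem that is needed: a closed walk inside m through all
    vertices.  A longest trail has exhausted all edges at its last vertex, so by
    parity it is closed.  It may then be rotated to end at any vertex that it
    visits, so it has exhausted the edges at all of them, and by connectivity it
    visits every vertex. *)
Lemma euler_tour m (x0 : 'I_n) : connected_mg m -> eulerian_mg m ->
  exists x p, [/\ last x p = x, forall u, u \in x :: p & forall e, (mult x p e <= m e)%N].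
Proof.
move=> /'forall_forallP cm /forallP em.
have [x [p [tp pmax]]] := longest_trail m x0; have [pp hp] := tp.
have stuck y q : trail m y q -> size q = size p ->
    forall e, last y q \in val e -> mult y q e = m e.
  move=> tq sq e /edge_ends [w [lw he]].
  apply/eqP; rewrite eqn_leq (tq.2 e) /= leqNgt; apply/negP => hlt.
  by have := pmax _ _ (trail_extend tq lw he hlt); rewrite size_rcons sq ltnn.
have lx : last x p = x.
  apply/eqP; apply: contraT => lx; have := em (last x p).
  rewrite -(eq_bigr _ (stuck x p tp erefl)) odd_degree_walk //.
  by rewrite eqxx (negbTE lx).
exists x, p; split => // u.
have full y : y \in x :: p -> forall e, y \in val e -> mult x p e = m e.
  rewrite inE => /orP [/eqP -> e|yp e]; first by rewrite -{1}lx; exact: stuck.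
  have [q [tq lq sq mq]] := trail_rot tp lx yp.
  by rewrite -mq -{1}lq; apply: stuck.
have /connectP [r hr ->] := cm x u.
move: hr; set g := SimplRel _ => hr.
suff walk y : path g y r -> y \in x :: p -> last y r \in x :: p.
  by apply: (walk x hr); rewrite inE eqxx.
elim: r {hr} y => [//|w r IH] y /= /andP [/existsP [e /andP [/eqP he m0]] hr] hy.
apply: IH hr _; apply: (@mult_mem x p e); last by rewrite [val e]he !inE eqxx orbT.
by rewrite (full y) // [val e]he !inE eqxx.
Qed.

End Walks.

Section Cost.
Context {R : realType} {n : nat}.
Implicit Types (u v w x y : 'I_n) (e : edge n) (p q s : seq 'I_n) (c : evec R n).

Definition cost c x p : R := \sum_(st <- steps x p) entry c st.1 st.2.

Lemma cost_cons c x y p : cost c x (y :: p) = entry c x y + cost c y p.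
Proof. by rewrite /cost /steps /= big_cons. Qed.

Lemma cost_nil c x : cost c x [::] = 0.
Proof. by rewrite /cost big_nil. Qed.

Lemma cost_mult c x p : cost c x p = \sum_e coord c e * (mult x p e)%:R.
Proof.
elim: p x => [|y p IH] x.
  by rewrite cost_nil big1 // => e _; rewrite mulr0.
rewrite cost_cons IH entry_sum -big_split; apply: eq_bigr => e _.
by rewrite mult_cons natrD mulrDr; case: ifP => _; rewrite ?mulr1 ?mulr0.
Qed.

(** Leaving out vertices of a walk does not make it longer, by the triangle
    inequality. *)
Lemma cost_shortcut c x q q' y : (2 < n)%N -> metric_cone c ->
  subseq q q' -> cost c x (rcons q y) <= cost c x (rcons q' y).
Proof.
move=> n3 mc; elim: q' q x => [|h t IH] q x; first by rewrite subseq0 => /eqP ->.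
case: q => [_|a q] /=.
  rewrite [X in _ <= X]cost_cons.
  apply: le_trans (lerD (lexx _) (IH [::] h (sub0seq _))).
  by rewrite /= !cost_cons !cost_nil !addr0 metric_triangle.
case: eqP => [-> |_] sq.
  by rewrite !cost_cons lerD2l IH.
rewrite [X in _ <= X]cost_cons.
apply: le_trans (lerD (lexx _) (IH _ h sq)).
by rewrite /= !cost_cons addrA lerD2r metric_triangle.
Qed.

Lemma steps_next x q : uniq (x :: q) ->
  steps x (rcons q x) = [seq (u, next (x :: q) u) | u <- x :: q].
Proof.
move=> us; rewrite /steps belast_rcons.
apply: (@eq_from_nth _ (x, x)); first by rewrite size_map size_zip size_rcons minnn.
move=> i; rewrite size_zip size_rcons minnn => hi.
rewrite nth_zip ?size_rcons // (nth_map x) // next_nth mem_nth //.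
congr (_, _); rewrite index_uniq // nth_rcons.
by case: ltnP => // h; rewrite nth_default //; case: eqP.
Qed.

(** In a cycle of length at least three a vertex is not its second successor; thus
    distinct steps use distinct edges. *)
Lemma next_next_neq s u : (2 < size s)%N -> uniq s -> u \in s ->
  next s (next s u) != u.
Proof.
move=> s3 us /rot_to [i s' hs].
rewrite -!(next_rot i us) hs; move: s3 us; rewrite -(size_rot i) -(rot_uniq i) hs.
case: s' {hs} => [|a [|b s']] //= _.
rewrite !inE eqxx !negb_or => /and3P [/and3P [ua ub _] _ _].
by rewrite (eq_sym a) (negbTE ua) eqxx eq_sym ub.
Qed.

Lemma cycle_step_inj s u v : (2 < size s)%N -> uniq s -> u \in s -> v \in s ->
  [set u; next s u]%SET = [set v; next s v]%SET -> u = v.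
Proof.
move=> s3 us hu hv h; apply/eqP; apply: contraT => uv.
have : v \in [set u; next s u]%SET by rewrite h !inE eqxx.
have : u \in [set v; next s v]%SET by rewrite -h !inE eqxx.
rewrite !inE (eq_sym v u) (negbTE uv) /= => /eqP e1 /eqP e2.
by have := next_next_neq s3 us hv; rewrite -e1 -e2 eqxx.
Qed.

Lemma hamilton_size s : hamilton s -> size s = n.
Proof.
move=> /andP [us /forallP h]; rewrite -(card_uniqP us) -[RHS]card_ord.
by apply: eq_card => u; rewrite h.
Qed.

(** The edge set of a Hamilton cycle, and the multigraph traversed by the closed
    walk around it, have the same characteristic vector. *)
Lemma cycle_mult x q e : (2 < n)%N -> hamilton (x :: q) ->
  (e \in cycle_edges (x :: q)) = mult x (rcons q x) e :> nat.
Proof.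
move=> n3 hs; have ss := hamilton_size hs; have /andP [us /forallP hall] := hs.
rewrite /mult steps_next // count_map.
set s := x :: q in us hall ss *.
set P := fun u => val e == [set u; next s u]%SET.
rewrite (@eq_count _ _ P) //.
have -> : count P s = #|[set u | P u]%SET|.
  rewrite -size_filter -(card_uniqP (filter_uniq _ us)).
  by apply: eq_card => u; rewrite inE mem_filter hall andbT.
rewrite inE; case: existsP => [[u hu]|h].
  rewrite (_ : finset _ = [set u]%SET) ?cards1 //.
  apply/finset.setP => v; rewrite !inE; apply/idP/eqP => [hv|-> //].
  apply: (@cycle_step_inj s) => //; rewrite ?ss //.
  by rewrite -(eqP hv); exact/eqP.
rewrite (_ : finset _ = finset.set0) ?cards0 //.
apply/finset.setP => u; rewrite !inE.
by apply/negP => hu; apply: h; exists u.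
Qed.

End Cost.


(** * Hamilton cycles *)

Section Tours.
Context {R : realType} {n : nat}.
Hypothesis n3 : (2 < n)%N.
Implicit Types (u v w x : 'I_n) (p q s : seq 'I_n) (e : edge n) (c : evec R n)
  (C : {set edge n}).

(** Hamilton cycles are handled through their edge sets, which range over a finite
    type. *)
Definition tour C : bool := `[< exists s, hamilton s /\ C = cycle_edges s >].

Lemma tour_cycle (s : seq 'I_n) : hamilton s -> tour (cycle_edges s).
Proof. by move=> hs; apply/asboolP; exists s. Qed.

Lemma hamilton_perm (s t : seq 'I_n) : perm_eq s t -> hamilton s = hamilton t.
Proof.
move=> st; rewrite /hamilton (perm_uniq st); congr (_ && _).
by apply: eq_forallb => u; rewrite (perm_mem st).
Qed.

Lemma tourP C : tour C -> exists x q, hamilton (x :: q) /\ C = cycle_edges (x :: q).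
Proof.
move=> /asboolP [[|x q] [hs ->]]; last by exists x, q.
by have := n3; rewrite -[X in (_ < X)%N](hamilton_size hs).
Qed.

Lemma coord_chi C e : coord (chi C : evec R n) e = (e \in C)%:R.
Proof. exact: (coord_row (fun e => (e \in C)%:R)). Qed.

Lemma dot_cycle c x q : hamilton (x :: q) ->
  dot c (chi (cycle_edges (x :: q))) = cost c x (rcons q x).
Proof.
move=> hs; rewrite cost_mult dot_coord; apply: eq_bigr => e _.
by rewrite coord_chi cycle_mult.
Qed.

Lemma path_proper x p : uniq (x :: p) -> path moving x p.
Proof.
elim: p x => [//|y p IH] x; rewrite cons_uniq inE negb_or -andbA => /and3P [xy _ up].
by rewrite /= IH // andbT.
Qed.

Lemma proper_cycle x q : hamilton (x :: q) -> path moving x (rcons q x).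
Proof.
move=> hs; have := hamilton_size hs; have /andP [us _] := hs.
rewrite rcons_path path_proper //=; case/lastP: q us {hs} => [|q y] us hs.
  by have := n3; rewrite -[X in (_ < X)%N]hs.
rewrite last_rcons; apply: contraTN us => /eqP <-.
by rewrite cons_uniq mem_rcons inE eqxx.
Qed.

Definition walk_vec x p : evec R n := \row_i (mult x p (enum_val i))%:R.

Lemma dot_walk_vec c x p : dot c (walk_vec x p) = cost c x p.
Proof.
rewrite cost_mult dot_coord; apply: eq_bigr => e _.
by rewrite (coord_row (fun e => (mult x p e)%:R)).
Qed.

Lemma connected_walk x p : path moving x p -> last x p = x ->
  (forall u, u \in x :: p) -> connected_mg (mult x p).
Proof.
move=> pp lx hall.
set g : rel 'I_n := fun u1 u2 => [exists e : edge n, (val e == [set u1;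
  u2]%SET) && (0 < mult x p e)%N].
have gsym : symmetric g.
  by move=> u v; apply: eq_existsb => e; rewrite finset.setUC.
have sub y q : path moving y q -> (forall e, mult y q e <= mult x p e)%N -> path g y q.
  elim: q y => [//|w q IH] y /= /andP [yw pq] hm; apply/andP; split.
    have [e he] := edge_of yw; apply/existsP; exists e; rewrite he eqxx /=.
    by apply: leq_trans (hm e); rewrite mult_cons he eqxx.
  by apply: IH => // e; apply: leq_trans (hm e); rewrite mult_cons leq_addl.
have con u : connect g x u.
  have := hall u; rewrite inE => /orP [/eqP ->|up]; first exact: connect0.
  have := sub _ _ pp (fun=> leqnn _); case/path.splitP: up => p1 p2.
  rewrite cat_path => /andP [h _]; apply/connectP; exists (rcons p1 u) => //.
  by rewrite last_rcons.
apply/'forall_forallP => u v.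
apply: (@connect_trans _ _ x); last exact: con.
by rewrite -[connect _ u x]/(connect g u x) (sym_connect_sym gsym).
Qed.

Lemma eulerian_walk x p : path moving x p -> last x p = x -> eulerian_mg (mult x p).
Proof.
by move=> pp lx; apply/forallP => u; rewrite odd_degree_walk // lx addbb.
Qed.

Lemma GTSP_walk_vec x p : path moving x p -> last x p = x ->
  (forall u, u \in x :: p) -> GTSP R n (walk_vec x p).
Proof.
move=> pp lx hall; apply: convex_hull_sub; exists (mult x p); split.
- exact: connected_walk.
- exact: eulerian_walk.
- by move=> e; rewrite (coord_row (fun e => (mult x p e)%:R)).
Qed.

Lemma chi_walk_vec x q : hamilton (x :: q) ->
  chi (cycle_edges (x :: q)) = walk_vec x (rcons q x).
Proof.
move=> hs; apply: coord_ext => e; rewrite coord_chi.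
by rewrite (coord_row (fun e => (mult x (rcons q x) e)%:R)) cycle_mult.
Qed.

Lemma GTSP_tour C : tour C -> GTSP R n (chi C).
Proof.
move=> /tourP [x [q [hs ->]]]; rewrite chi_walk_vec //; apply: GTSP_walk_vec.
- exact: proper_cycle.
- by rewrite last_rcons.
- move=> u; have /andP [_ /forallP /(_ u)] := hs.
  by rewrite !inE mem_rcons inE => /orP [] ->; rewrite ?orbT.
Qed.

Lemma STSP_tour C : tour C -> STSP R n (chi C).
Proof. by move=> /asboolP [s [hs ->]]; apply: convex_hull_sub; exists s. Qed.

(** An Euler tour of a connected Eulerian multigraph costs at most as much as the
    multigraph, metric costs being nonnegative, and can be shortcut to a Hamilton
    cycle. *)
Lemma metric_valid_GTSP c g : metric_cone c ->
  (forall C, tour C -> g <= dot c (chi C)) -> valid (GTSP R n) c g.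
Proof.
move=> mc hg; apply: convex_hull_valid => y [m [cm em hm]].
have x0 : 'I_n by apply: (@Ordinal n 0); exact: ltn_trans n3.
have [x [p [lx hall mle]]] := euler_tour x0 cm em.
have hc : cost c x p <= dot c y.
  rewrite cost_mult dot_coord; apply: ler_sum => e _; rewrite hm.
  apply: ler_wpM2l; last by rewrite ler_nat.
  by have [u [v [_ he]]] := edge_pair e; rewrite -(entry_coord _ he) metric_nneg.
apply: le_trans hc.
case/lastP: p lx hall {mle} => [|p y'] lx hall.
  have : #|[set: 'I_n]%SET| = 1%N.
    by apply/eqP/cards1P; exists x; apply/finset.setP => u; have := hall u; rewrite !inE.
  by rewrite cardsT card_ord => n1; have := n3; rewrite [X in (_ < X)%N]n1.
rewrite last_rcons in lx; subst y'.
pose q := undup [seq u <- p | u != x].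
have hs : hamilton (x :: q).
  apply/andP; split.
    by rewrite cons_uniq undup_uniq andbT mem_undup mem_filter eqxx.
  apply/forallP => u; have := hall u; rewrite !inE mem_rcons inE mem_undup mem_filter.
  by case: (u == x).
apply: le_trans (hg _ (tour_cycle hs)) _; rewrite dot_cycle //.
apply: cost_shortcut => //; apply: subseq_trans (filter_subseq (fun u => u != x) _).
exact: undup_subseq.
Qed.

Lemma cycle_edges_rot i s : uniq s -> cycle_edges (rot i s) = cycle_edges s.
Proof.
move=> us; apply/finset.setP => e; rewrite !inE; apply: eq_existsb => u.
by rewrite next_rot.
Qed.

(** Rotate the listing of the cycle until it starts with the given edge. *)
Lemma tour_through C e : tour C -> e \in C -> exists v w q,
  [/\ val e = [set v; w]%SET, hamilton (v :: w :: q) & C = cycle_edges (v :: w :: q)].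
Proof.
move=> /asboolP [s [hs ->]]; have /andP [us /forallP hall] := hs.
rewrite inE => /existsP [u /eqP hu].
have [i s' hr] := rot_to (hall u).
have hs' : hamilton (u :: s') by rewrite -hr (hamilton_perm (permEl (perm_rot i s))).
rewrite -(cycle_edges_rot i us) hr; move: hu; rewrite -(next_rot i us) hr.
case: s' hs' {hr} => [|w q] hs' /=.
  by have := n3; rewrite -[X in (_ < X)%N](hamilton_size hs').
by rewrite eqxx => he; exists u, w, q.
Qed.

(** Replace the edge vw of the tour by the two edges vu and uw.  The result is a
    closed walk through all vertices, hence gives a point of the graphical
    polyhedron, and its cost exceeds that of the tour by the triangle slack. *)
Lemma detour C e u v w : tour C -> e \in C -> val e = [set v; w]%SET ->
  distinct3 u v w ->
  exists y, GTSP R n y /\ forall c, dot c y = dot c (chi C) + tri u v w c.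
Proof.
move=> tC eC he [/eqP uv /eqP uw /eqP vw].
have [v' [w' [q [he' hs eqC]]]] := tour_through tC eC.
exists (walk_vec v' (u :: w' :: rcons q v')).
have htri c : tri u v w c = tri u v' w' c.
  have : v' \in [set v; w]%SET by rewrite -he he' !inE eqxx.
  rewrite !inE => /orP [] /eqP h; rewrite {}h in he' *.
    by rewrite he in he'; rewrite (set2_inj he').
  by rewrite he finset.setUC in he'; rewrite (set2_inj he') triC.
have uv' : u \notin [set v'; w']%SET by rewrite -he' he !inE negb_or uv uw.
move: uv'; rewrite !inE negb_or => /andP [uv' uw'].
split.
  apply: GTSP_walk_vec.
  - have /andP [_ pq] := proper_cycle hs.
    by apply/and3P; split => //; rewrite /moving eq_sym.
  - by rewrite /= last_rcons.
  - move=> x; have /andP [_ /forallP /(_ x)] := hs.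
    by rewrite !inE mem_rcons inE => /orP [->//|/orP [] ->]; rewrite !orbT.
move=> c; rewrite dot_walk_vec eqC dot_cycle // htri /= !cost_cons /tri.
by ring.
Qed.

Lemma cost_delta u x p : path moving x p ->
  cost (delta u : evec R n) x p
  = 2^-1 * ((count_mem u (belast x p))%:R + (count_mem u p)%:R).
Proof.
elim: p x => [|y p IH] x /=; first by rewrite cost_nil addr0 mulr0.
move=> /andP [xy pp]; rewrite cost_cons IH // entry_delta // !natrD !(eq_sym u).
by ring.
Qed.

Lemma dot_delta_tour u C : tour C -> dot (delta u : evec R n) (chi C) = 1.
Proof.
move=> /tourP [x [q [hs ->]]]; rewrite dot_cycle // cost_delta ?proper_cycle //.
have /andP [us /forallP hall] := hs.
rewrite belast_rcons.
have -> : count_mem u (rcons q x) = count_mem u (x :: q).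
  by apply/permP; rewrite perm_rcons.
rewrite count_uniq_mem // hall /=.
by lra.
Qed.

Lemma dot_delta_z u : dot (delta u : evec R n) z = 1.
Proof.
rewrite dot_delta (bigD1 u) //= entry_diag add0r.
rewrite (eq_bigr (fun=> 2 / n.-1%:R)); last first.
  move=> v vu; have [e he] : exists e : edge n, val e = [set u; v]%SET.
    by apply: edge_of; rewrite eq_sym.
  by rewrite (entry_coord _ he) /coord mxE.
rewrite sumr_const cardC1 card_ord -mulr_natr.
have nz : n.-1%:R != 0 :> R by rewrite pnatr_eq0; case: n n3 => [|[|]].
by field.
Qed.

Lemma tour_sub_z C : tour C -> L (chi C - z : evec R n).
Proof. by move=> tC u; rewrite dotBr dot_delta_tour // dot_delta_z subrr. Qed.

End Tours.


(** * Rigidity of the tours that avoid an edge *)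

Section Rigidity.
Context {R : realType} {n : nat}.
Hypothesis n5 : (4 < n)%N.
Variables (d : evec R n) (e : edge n).
Hypothesis dL : L d.
Hypothesis d0 : forall C, tour C -> e \notin C -> dot d (chi C) = 0.
Implicit Types (u v w x : 'I_n) (p q s : seq 'I_n).

Let n3 : (2 < n)%N. Proof. exact: ltn_trans n5. Qed.

Definition avoids : rel 'I_n := fun x y => val e != [set x; y]%SET.

Lemma avoids_notin v x y : v \in val e -> v != x -> v != y -> avoids x y.
Proof.
move=> ve vx vy; apply: contraTneq ve => ->.
by rewrite !inE negb_or vx.
Qed.

Lemma avoids_path v x p : v \in val e -> v \notin x :: p -> path avoids x p.
Proof.
move=> ve; elim: p x => [//|y p IH] x; rewrite inE negb_or => /andP [vx vp].
rewrite /= IH // andbT; apply: avoids_notin ve vx _.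
by move: vp; rewrite inE negb_or => /andP [].
Qed.

Lemma avoids_mult x p : path avoids x p -> mult x p e = 0%N.
Proof.
elim: p x => [//|y p IH] x /= /andP [oxy /IH h]; rewrite mult_cons h.
by rewrite (negbTE oxy).
Qed.

Lemma cost_avoids x q : hamilton (x :: q) -> path avoids x (rcons q x) ->
  cost d x (rcons q x) = 0.
Proof.
move=> hs oq; rewrite -dot_cycle // d0 ?tour_cycle //.
apply/negP => ce; have := cycle_mult e n3 hs.
by rewrite ce avoids_mult.
Qed.

Lemma avoids_sym x y : avoids x y = avoids y x.
Proof. by rewrite /avoids finset.setUC. Qed.

(** Compare the Hamilton cycles a b b' c q and a b' b c q: they share all edges but
    four. *)
Lemma exchange0 a b b' c q : hamilton [:: a, b, b', c & q] ->
  avoids b b' -> avoids a b -> avoids b' c -> avoids a b' -> avoids b c ->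
  path avoids c (rcons q a) ->
  entry d a b + entry d b' c = entry d a b' + entry d b c.
Proof.
move=> hs o1 o2 o3 o4 o5 oq.
have h1 : cost d a (rcons [:: b, b', c & q] a) = 0.
  by apply: cost_avoids => //=; rewrite o1 o2 o3.
have h2 : cost d a (rcons [:: b', b, c & q] a) = 0.
  apply: cost_avoids; last by rewrite /= o4 o5 oq (avoids_sym b' b) o1.
  rewrite -(hamilton_perm (s := [:: a, b, b', c & q])) //.
  by apply/permP => P /=; ring.
by move: h1 h2; rewrite /= !cost_cons (entryC d b' b); lra.
Qed.

(** The same exchange with a vertex r between b and b', which keeps both cycles away
    from the edge bb'. *)
Lemma exchange1 a b b' c r q : hamilton [:: a, b, b', c, r & q] ->
  avoids b r -> avoids r b' -> avoids a b -> avoids b' c -> avoids a b' -> avoids b c ->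
  path avoids c (rcons q a) ->
  entry d a b + entry d b' c = entry d a b' + entry d b c.
Proof.
move=> hs o0 o1 o2 o3 o4 o5 oq.
have h1 : cost d a (rcons [:: b, r, b', c & q] a) = 0.
  apply: cost_avoids; last by rewrite /= o0 o1 o2 o3.
  rewrite -(hamilton_perm (s := [:: a, b, b', c, r & q])) //.
  by apply/permP => P /=; ring.
have h2 : cost d a (rcons [:: b', r, b, c & q] a) = 0.
  apply: cost_avoids.
    rewrite -(hamilton_perm (s := [:: a, b, b', c, r & q])) //.
    by apply/permP => P /=; ring.
  by rewrite /= o4 o5 oq (avoids_sym b' r) o1 (avoids_sym r b) o0.
by move: h1 h2; rewrite /= !cost_cons (entryC d b' r) (entryC d r b); lra.
Qed.

Lemma complete_hamilton s : uniq s -> exists q, hamilton (s ++ q).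
Proof.
move=> us; exists [seq x <- enum 'I_n | x \notin s]; apply/andP; split.
  rewrite cat_uniq us filter_uniq ?enum_uniq // andbT /=.
  by apply/hasPn => x; rewrite mem_filter => /andP [].
by apply/forallP => u; rewrite mem_cat mem_filter mem_enum inE andbT orbN.
Qed.

(** If e = ac, or if exactly one end of e is among b and b', then exchange0 applies.
    Otherwise e = bb' or e is disjoint from the four vertices; in that case
    exchange1 with a suitable r keeps e out of both cycles. *)
Lemma exchange a b b' c : uniq [:: a; b; b'; c] ->
  val e = [set a; c]%SET \/ (a \notin val e /\ c \notin val e) ->
  entry d a b + entry d b' c = entry d a b' + entry d b c.
Proof.
move=> us hac; have [q hq] := complete_hamilton us.
have hsz := hamilton_size hq; have /andP [uq /forallP hall] := hq.
have [ab [ab' [ac [bb' [bc b'c]]]]] : a != b /\ a != b' /\ a != c /\ b != b' /\ b != c /\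
  b' != c.
  by move: us; rewrite /= !inE !negb_or -!andbA => /and5P [-> -> -> -> /and3P [-> ->]].
have [aq [bq [b'q cq]]] : a \notin q /\ b \notin q /\ b' \notin q /\ c \notin q.
  by move: uq; rewrite /= !inE !negb_or -!andbA => /and5P [_ _ _ -> /and5P [_ _ ->
    _ /and3P [-> -> _]]].
have [r [q' eq_q]] : exists r q', q = r :: q'.
  case: q hsz {hq uq hall aq bq b'q cq} => [|r q'] hsz; last by exists r, q'.
  by have := n5; rewrite -[X in (_ < X)%N]hsz.
case: hac => [eac|[ae ce]].
  have a_e : a \in val e by rewrite eac !inE eqxx.
  have c_e : c \in val e by rewrite eac !inE eqxx orbT.
  apply: (exchange0 hq).
  - by apply: avoids_notin a_e _ _.
  - by apply: avoids_notin c_e _ _; rewrite eq_sym.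
  - by apply: avoids_notin a_e _ _.
  - by apply: avoids_notin c_e _ _; rewrite eq_sym.
  - by apply: avoids_notin a_e _ _.
  - move: aq cq; rewrite eq_q !inE !negb_or => /andP [ar aq] /andP [cr cq] /=.
    rewrite (avoids_notin a_e) //=; apply: (avoids_path c_e).
    by rewrite inE mem_rcons inE !negb_or cr cq eq_sym ac.
have offl x y : x \notin val e -> avoids x y.
  by apply: contraNN => /eqP ->; rewrite !inE eqxx.
have offr x y : y \notin val e -> avoids x y.
  by apply: contraNN => /eqP ->; rewrite !inE eqxx orbT.
have [be|be] := boolP (b \in val e); have [b'e|b'e] := boolP (b' \in val e).
- rewrite eq_q in hq bq b'q aq.
  move: bq b'q; rewrite !inE !negb_or => /andP [br bq] /andP [b'r b'q].
  apply: (exchange1 hq); auto.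
  + by apply: (avoids_notin b'e) => //; rewrite eq_sym.
  + by apply: (avoids_notin be).
  + by apply: (avoids_path be); rewrite inE mem_rcons inE !negb_or bc eq_sym ab.
- apply: (exchange0 hq); auto.
  by apply: (avoids_path be); rewrite inE mem_rcons inE !negb_or bc eq_sym ab.
- apply: (exchange0 hq); auto.
  by apply: (avoids_path b'e); rewrite inE mem_rcons inE !negb_or b'c eq_sym ab'.
have [p1 [p2 [_ e12]]] := edge_pair e.
have p1e : p1 \in val e by rewrite e12 !inE eqxx.
have neq x : x \notin val e -> p1 != x by apply: contraNneq => <-.
have p1q : p1 \in q.
  by have := hall p1; rewrite !inE !(negbTE (neq _ _)).
have hq' : hamilton [:: a, b, b', c, p1 & rem p1 q].
  rewrite -(hamilton_perm (s := [:: a, b, b', c & q])) // !perm_cons.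
  exact: perm_to_rem.
apply: (exchange1 hq'); auto.
apply: (avoids_path p1e); rewrite inE mem_rcons inE !negb_or !neq //=.
by rewrite mem_rem_uniqF //; move: uq => /= /and5P [].
Qed.

Lemma row_sum u : \sum_v entry d u v = 0.
Proof.
have := dL u; rewrite dot_delta => /eqP; rewrite mulf_eq0 invr_eq0.
by rewrite pnatr_eq0 /= => /eqP.
Qed.

(** By exchange, the difference of the rows i and j of d does not depend on the
    column; it is 0 since both rows of an element of L have the sum 0. *)
Lemma twins i j k : i != j -> k != i -> k != j ->
  val e = [set i; j]%SET \/ (i \notin val e /\ j \notin val e) ->
  entry d i k = entry d j k.
Proof.
move=> ij ki kj he.
have key l : l != i -> l != j -> entry d i l - entry d j l = entry d i k - entry d j k.
  move=> li lj; have [->//|lk] := eqVneq l k.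
  have := @exchange i k l j; rewrite (entryC d l j) (entryC d k j) => H.
  suff : entry d i k + entry d j l = entry d i l + entry d j k by lra.
  by apply: H he; rewrite /= !inE !negb_or (eq_sym i) ki (eq_sym i) li ij
    (eq_sym k) lk kj lj.
have h1 : \sum_(l | (l != i) && (l != j)) entry d i l = - entry d i j.
  have := row_sum i; rewrite (bigD1 i) //= entry_diag add0r (bigD1 j) 1?eq_sym //=.
  by move/eqP; rewrite addrC addr_eq0 => /eqP.
have h2 : \sum_(l | (l != i) && (l != j)) entry d j l = - entry d i j.
  have := row_sum j; rewrite (bigD1 j) //= entry_diag add0r (bigD1 i) //=.
  rewrite (entryC d j i) addrC => /eqP; rewrite addr_eq0 => /eqP <-.
  by apply: eq_bigl => l; rewrite andbC.
have h3 : \sum_(l | (l != i) && (l != j)) (entry d i l - entry d j l) = 0.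
  by rewrite sumrB h1 h2 subrr.
rewrite (eq_bigr (fun=> entry d i k - entry d j k)) in h3; last first.
  by move=> l /andP [li lj]; apply: key.
move/eqP: h3; rewrite sumr_const -mulr_natr mulf_eq0 pnatr_eq0 subr_eq0.
case/orP => [/eqP //|/eqP h]; exfalso.
by move: (card0_eq h k); rewrite /in_mem /= ki kj.
Qed.

(** The equations for the tours that avoid e determine an element of L.  By twins,
    d has one value al on the edges disjoint from e and one value be on the edges
    that meet e in a single vertex, so off e it agrees with a potential.  The total
    weight of this potential is its value on any tour that avoids e, namely 0, and
    then the row sums leave only d = 0. *)
Lemma rigidity : d = 0.
Proof.
have [p [r [pr epr]]] := edge_pair e.
have pe : p \in val e by rewrite epr !inE eqxx.
have re : r \in val e by rewrite epr !inE eqxx orbT.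
have [q hq] : exists q, hamilton [:: p, r & q].
  by apply: (@complete_hamilton [:: p; r]); rewrite /= inE pr.
have hsz := hamilton_size hq; have /andP [uq /forallP hall] := hq.
have [k0 [k1 [q' eq_q]]] : exists k0 k1 q', q = [:: k0, k1 & q'].
  case: q hsz {hq uq hall} => [|k0 [|k1 q']] hsz; try by (have := n5;
    rewrite -[X in (_ < X)%N]hsz).
  by exists k0, k1, q'.
rewrite {}eq_q in hq uq hsz hall.
have [pk0 [pk1 [rk0 [rk1 [k01 [rq pq]]]]]] : p != k0 /\ p != k1 /\ r != k0 /\ r != k1 /\
  k0 != k1 /\ r \notin q' /\ p \notin q'.
  move: uq; rewrite /= !inE !negb_or => /and5P [/and4P [_ -> -> ->] /and3P [-> -> ->]].
  by move=> /andP [->].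
have out k : (k \notin val e) = (k != p) && (k != r) by rewrite epr !inE negb_or.
have k0e : k0 \notin val e by rewrite out !(eq_sym k0) pk0 rk0.
have k1e : k1 \notin val e by rewrite out !(eq_sym k1) pk1 rk1.
pose al := entry d k0 k1; pose be := entry d p k0.
have hp k : k \notin val e -> entry d p k = be.
  move=> ke; have [->//|kk0] := eqVneq k k0.
  rewrite /be !(entryC d p); apply: twins => //; last by right.
  by move: ke; rewrite out eq_sym => /andP [].
have hr k : k \notin val e -> entry d r k = be.
  move=> ke; rewrite -(hp k ke); move: ke; rewrite out => /andP [kp kr].
  by symmetry; apply: twins => //; left.
have hal i j : i \notin val e -> j \notin val e -> i != j -> entry d i j = al.
  have k0j k : k \notin val e -> k != k0 -> entry d k0 k = al.
    move=> ke kk0; have [->//|kk1] := eqVneq k k1.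
    rewrite /al !(entryC d k0); apply: twins => //; first by rewrite eq_sym.
    by right.
  move=> ie je ij; have [ik0|ik0] := eqVneq i k0; first by rewrite ik0 k0j // -ik0 eq_sym.
  have [jk0|jk0] := eqVneq j k0; first by rewrite jk0 entryC k0j.
  rewrite -(k0j j je jk0); apply: twins => //; [by rewrite eq_sym|by right].
(* The weights for which half the sum of two of them is al, be off e. *)
pose l u : R := if u \in val e then 2 * be - al else al.
have dl u v : u != v -> avoids u v -> entry d u v = (l u + l v) / 2.
  move=> uv; rewrite /avoids /l => ouv.
  have memE x : x \in val e -> x = p \/ x = r.
    by rewrite epr !inE => /orP [] /eqP; auto.
  case: ifPn => ue; case: ifPn => ve.
  - exfalso; move: ouv uv.
    by case: (memE u ue) (memE v ve) => -> [] ->;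
      rewrite ?eqxx // epr ?eqxx // finset.setUC eqxx.
  - have -> : entry d u v = be by case: (memE u ue) => ->; auto.
    by lra.
  - have -> : entry d u v = be by rewrite entryC; case: (memE v ve) => ->; auto.
    by lra.
  - by rewrite hal //; lra.
have suml : \sum_u l u = 0.
  (* A tour avoids e once k0 and k1 separate p and r on both sides. *)
  have hC : hamilton [:: p, k0, r, k1 & q'].
    rewrite -(hamilton_perm (s := [:: p, r, k0, k1 & q'])) //.
    by apply/permP => P /=; ring.
  have op : path avoids p (rcons [:: k0, r, k1 & q'] p).
    have rp : r != p by rewrite eq_sym.
    apply/and4P; split; [exact: (avoids_notin re)|exact: (avoids_notin pe)..|].
    by apply: (avoids_path re); rewrite inE mem_rcons inE !negb_or rk1 rq rp.
  have := cost_avoids hC op.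
  have <- : cost (potential l) p (rcons [:: k0, r, k1 & q'] p) = \sum_u l u.
    rewrite -dot_cycle // dot_potential; apply: eq_bigr => u _.
    by rewrite dot_delta_tour ?mulr1 // tour_cycle.
  suff h x s : path avoids x s -> path (@moving n) x s ->
    cost d x s = cost (potential l) x s.
    by rewrite h // (proper_cycle n3 hC).
  elim: s x => [|y s IH] x; first by rewrite !cost_nil.
  move=> /= /andP [oxy os] /andP [xy ps].
  by rewrite !cost_cons IH // dl // entry_potential.
have al0 : al = 0.
  have := row_sum k0; rewrite (bigD1 k0) //= entry_diag add0r.
  rewrite (eq_bigr (fun v => (l k0 + l v) / 2)); last first.
    move=> v vk0; apply: dl; first by rewrite eq_sym.
    have [hv|hv] := eqVneq p v; last by apply: (avoids_notin pe).
    by apply: (avoids_notin re) => //; rewrite -hv eq_sym.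
  rewrite -mulr_suml big_split /= => h.
  have hs : \sum_(v < n | v != k0) l v = - l k0.
    by move: suml; rewrite (bigD1 k0) //= => /eqP; rewrite addrC addr_eq0 => /eqP.
  rewrite hs sumr_const cardC1 card_ord /l (negbTE k0e) in h.
  have [n1 n2] : (n.-1 = n.-2.+1 /\ n.-2 != 0)%N.
    by move: n5; clear; case: n => [|[|[|m]]].
  move: h; rewrite n1.
  rewrite mulrS addrAC subrr add0r => /eqP.
  rewrite mulf_eq0 invr_eq0 pnatr_eq0 orbF mulrn_eq0 (negbTE n2) /= => /eqP.
  exact.
have be0 : be = 0.
  move: suml; rewrite /l al0 subr0 -big_mkcond /= sumr_const (eqP (valP e)).
  by rewrite -mulr_natr; lra.
have doff u v : u != v -> avoids u v -> entry d u v = 0.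
  by move=> uv o; rewrite dl // /l al0 be0; case: ifP; case: ifP; lra.
have dpr : entry d p r = 0.
  have := row_sum p; rewrite (bigD1 p) //= entry_diag add0r (bigD1 r) 1?eq_sym //=.
  rewrite big1 ?addr0 // => v /andP [vp vr]; apply: doff; first by rewrite eq_sym.
  by apply: (avoids_notin re); rewrite eq_sym // eq_sym.
apply: entry_ext => u v uv; rewrite [RHS]entry_dot dot0r.
have [ouv|] := boolP (avoids u v); first exact: doff.
rewrite negbK => /eqP h.
have {}h := etrans (esym epr) h.
have : u \in [set p; r]%SET by rewrite h !inE eqxx.
rewrite !inE => /orP [] /eqP hu; move: h; rewrite hu => h.
  by rewrite -(set2_inj h).
by rewrite finset.setUC in h; rewrite -(set2_inj h) entryC.
Qed.

End Rigidity.


(** * Minimal triangle slacks and the flat TT-fan *)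

Section Minima.
Context {R : realType} {n : nat}.
Hypothesis n3 : (2 < n)%N.
Implicit Types (u v w : 'I_n) (a b d q x y : evec R n).

(** A triple (u, v, w) stands for the triangle inequality at u with opposite edge
    vw. *)
Definition triple := ('I_n * 'I_n * 'I_n)%type.
Implicit Types (s t : triple).

Definition distinct_triple t := [&& t.1.1 != t.1.2, t.1.1 != t.2 & t.1.2 != t.2].
Definition tri3 t a := tri t.1.1 t.1.2 t.2 a.
Definition tri_vec3 t : evec R n := tri_vec t.1.1 t.1.2 t.2.

Lemma distinct_tripleP t : reflect (distinct3 t.1.1 t.1.2 t.2) (distinct_triple t).
Proof.
apply: (iffP and3P) => [[h1 h2 h3]|[/eqP h1 /eqP h2 /eqP h3]] //.
by split; apply/eqP.
Qed.

Lemma tri3_dot t a : tri3 t a = dot (tri_vec3 t) a.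
Proof. exact: tri_dot. Qed.

Lemma ex_triple u : exists t, distinct_triple t /\ t.1.1 = u.
Proof.
have [v /andP [vu _]] := ex_third u u n3.
have [w /andP [wu wv]] := ex_third u v n3.
by exists (u, v, w); rewrite /distinct_triple /= !(eq_sym u) vu wu eq_sym wv.
Qed.

(** The infimum is a minimum over a finite nonempty set. *)
Lemma tmin_spec u a : exists t, [/\ distinct_triple t, t.1.1 = u, tri3 t a = tmin u a
  & forall s, distinct_triple s -> s.1.1 = u -> tri3 t a <= tri3 s a].
Proof.
have [t0 [d0 e0]] := ex_triple u.
have P0 : (distinct_triple t0) && (t0.1.1 == u) by rewrite d0 e0 eqxx.
case: (@Order.TotalTheory.arg_minP _ _ _ t0
  (fun t => distinct_triple t && (t.1.1 == u)) (tri3^~ a) P0) => t /andP [dt /eqP et] tmn.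
have lb v w : distinct3 u v w -> tri3 t a <= tri u v w a.
  move=> h; apply: (tmn (u, v, w)); rewrite /= eqxx andbT.
  exact/(distinct_tripleP (u, v, w)).
exists t; split => //; last by move=> s ds es; apply: tmn; rewrite ds es eqxx.
rewrite /tmin; set A := (X in inf X).
have At : A (tri3 t a).
  by exists t.1.2, t.2; rewrite -et; split => //; exact/distinct_tripleP.
apply/le_anti/andP; split.
  by apply: lb_le_inf; [exists (tri3 t a) | move=> r [v [w [/lb h ->]]]].
by apply: ge_inf => //; exists (tri3 t a) => r [v [w [/lb h ->]]].
Qed.

Lemma tmin_le t a : distinct_triple t -> tmin t.1.1 a <= tri3 t a.
Proof.
by move=> dt; have [s [_ _ <- h]] := tmin_spec t.1.1 a; apply: h.
Qed.

(** All the sets Eu u a at once, as a subset of one finite type; see EuP. *)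
Definition min_triples a : {set triple} :=
  [set t | distinct_triple t && (tri3 t a == tmin t.1.1 a)]%SET.

Lemma ex_min_triples u a : exists t, t \in min_triples a /\ t.1.1 = u.
Proof.
by have [t [dt et h _]] := tmin_spec u a; exists t; rewrite inE dt h et eqxx.
Qed.

Lemma min_triplesP t a : reflect
  (distinct_triple t /\ forall s, distinct_triple s -> s.1.1 = t.1.1 ->
    tri3 t a <= tri3 s a)
  (t \in min_triples a).
Proof.
rewrite inE; apply: (iffP andP) => [[dt /eqP et]|[dt h]]; split => //.
  by move=> s ds es; rewrite et -es tmin_le.
rewrite eq_le tmin_le // andbT.
by have [s [ds es <- _]] := tmin_spec t.1.1 a; apply: h.
Qed.

Lemma min_triples_eq s t a : s \in min_triples a -> t \in min_triples a ->
  s.1.1 = t.1.1 ->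
  tri3 s a = tri3 t a.
Proof. by rewrite !inE => /andP [_ /eqP ->] /andP [_ /eqP ->] ->. Qed.

Lemma min_triples_from s t a : s \in min_triples a -> distinct_triple t ->
  s.1.1 = t.1.1 ->
  tri3 s a = tri3 t a -> t \in min_triples a.
Proof. by rewrite !inE => /andP [_ /eqP es] -> e1 e2; rewrite -e2 es e1 eqxx. Qed.

Lemma EuP a b : (forall u : 'I_n, Eu u a = Eu u b) <-> min_triples a = min_triples b.
Proof.
have sub c c' : (forall u : 'I_n, Eu u c = Eu u c') ->
  min_triples c \subset min_triples c'.
  move=> h; apply/fintype.subsetP => t; rewrite !inE => /andP [dt /eqP et].
  have /distinct_tripleP dt' := dt; have [_ _ /eqP vw] := dt'.
  have [e he] := edge_of vw.
  have : Eu t.1.1 c e.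
    by exists t.1.2, t.2; split; [exact: dt'|exact: he|exact: et].
  rewrite h => -[v [w [d' e' m']]]; rewrite dt /= -m' /tri3.
  have {}e' := etrans (esym he) e'.
  have : v \in [set t.1.2; t.2]%SET by rewrite e' !inE eqxx.
  rewrite !inE => /orP [] /eqP hv; rewrite {}hv in e' *.
    by rewrite (set2_inj e').
  by rewrite finset.setUC in e'; rewrite -(set2_inj e') triC.
split=> [h|h u]; first by apply/eqP; rewrite finset.eqEsubset !sub.
have sub2 c c' : min_triples c = min_triples c' -> Eu u c `<=` Eu u c'.
  move=> hc e [v [w [d' e' m']]]; exists v, w; split => //.
  have : (u, v, w) \in min_triples c by rewrite inE /tri3 /= m' eqxx andbT;
    apply/(distinct_tripleP (u, v, w)).
  by rewrite hc inE => /andP [_ /eqP].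
by apply/seteqP; split; apply: sub2.
Qed.

Lemma tri3D t a b : tri3 t (a + b) = tri3 t a + tri3 t b.
Proof. by rewrite !tri3_dot dotDr. Qed.

Lemma tri3B t a b : tri3 t (a - b) = tri3 t a - tri3 t b.
Proof. by rewrite !tri3_dot dotBr. Qed.

Lemma tri3Z t k b : tri3 t (k *: b) = k * tri3 t b.
Proof. by rewrite !tri3_dot dotZr. Qed.

Lemma tri3_potential t l : distinct_triple t -> tri3 t (potential l : evec R n) = l t.1.1.
Proof. by move=> /distinct_tripleP; exact: tri_potential. Qed.

(** Comparing slacks at the same vertex u is insensitive to node weights. *)
Lemma min_triples_potential a l : min_triples (a + potential l) = min_triples a.
Proof.
apply/finset.setP => t; apply/min_triplesP/min_triplesP => -[dt h]; split => // s ds es;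
  by have := h s ds es; rewrite !tri3D !tri3_potential // es lerD2r.
Qed.

Lemma min_triples_mid (T0 : {set triple}) a b : T0 \subset min_triples a ->
  T0 \subset min_triples b ->
  T0 \subset min_triples (midpoint a b).
Proof.
move=> /fintype.subsetP xa /fintype.subsetP xb; apply/fintype.subsetP => t tx.
have /min_triplesP [dt ha] := xa t tx; have /min_triplesP [_ hb] := xb t tx.
apply/min_triplesP; split => // s ds es; rewrite !tri3_dot !dot_mid -!tri3_dot.
by have := ha s ds es; have := hb s ds es; lra.
Qed.

Lemma metric3 d : metric_cone d <-> forall t, distinct_triple t -> 0 <= tri3 t d.
Proof.
split=> [h t /distinct_tripleP|h u v w duv]; first exact: h.
by apply: (h (u, v, w)); apply/(distinct_tripleP (u, v, w)).
Qed.

Lemma Lperp_potential l : Lperp (potential l : evec R n).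
Proof. by move=> x Lx; rewrite dot_potential big1 // => u _; rewrite Lx mulr0. Qed.

Lemma dot_delta_tri_vec u t : distinct_triple t -> dot (delta u) (tri_vec3 t) =
  (u == t.1.1)%:R.
Proof.
rewrite dotC -tri3_dot /tri3 /tri => /and3P [h1 h2 h3].
by rewrite !entry_delta // 1?eq_sym //; lra.
Qed.

Lemma tri3_Lperp q s t : Lperp q -> distinct_triple s -> distinct_triple t ->
  s.1.1 = t.1.1 ->
  tri3 s q = tri3 t q.
Proof.
move=> Lq ds dt est; apply/eqP; rewrite -subr_eq0 !tri3_dot -dotBl dotC.
by rewrite Lq // => u; rewrite dotBr !dot_delta_tri_vec // est subrr.
Qed.

(** As a vector, a triangle slack at u has the product 1 with delta u and 0 with
    every other delta, so two slacks at u differ by an element of L and agree on q.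
    Subtracting them as node weights leaves a vector all of whose triangle slacks
    vanish, and hence all of whose entries do. *)
Lemma LperpP q : Lperp q -> exists l, q = potential l.
Proof.
move=> Lq; exists (tmin^~ q).
have h0 u v w : distinct3 u v w -> tri u v w (q - potential (tmin^~ q)) = 0.
  move=> /(distinct_tripleP (u, v, w)) dt.
  rewrite -[LHS]/(tri3 (u, v, w) _) tri3B tri3_potential //.
  have [s [ds es <- _]] := tmin_spec u q.
  by rewrite (tri3_Lperp Lq ds dt es) subrr.
apply/eqP; rewrite -subr_eq0; apply/eqP; apply: entry_ext => u v uv.
have [w /andP [wu wv]] := ex_third u v n3.
have /eqP := tri_sum (q - potential (tmin^~ q)) u v w.
rewrite !h0; try by split; apply/eqP; rewrite // eq_sym.
by rewrite addr0 eq_sym mulrn_eq0 /= => /eqP ->; rewrite entry_dot dot0r.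
Qed.

Lemma dot_delta_potential u l : dot (delta u) (potential l : evec R n) =
  4^-1 * (l u *+ n.-2 + \sum_v l v).
Proof.
rewrite dot_delta (bigD1 u) //= entry_diag add0r.
rewrite (eq_bigr (fun v => (l u + l v) / 2)); last first.
  by move=> v vu; rewrite entry_potential // eq_sym.
rewrite -mulr_suml big_split /= sumr_const cardC1 card_ord.
rewrite [\sum_v l v](bigD1 u) //=.
have -> : n.-1 = n.-2.+1 by case: n n3 => [|[|]].
by rewrite mulrS; field.
Qed.

(** The normal equations for the node weights read
    (n-2) l_u + sum l = 4 (delta_u . d).  Summing them over u gives the total
    weight, and then each l_u. *)
Lemma orth_decomposition d : exists l, L (d - potential l).
Proof.
pose S := \sum_u dot (delta u) d.
have nz : n.-2%:R != 0 :> R by rewrite pnatr_eq0; case: n n3 => [|[|[|]]].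
have nz1 : n.-1%:R != 0 :> R by rewrite pnatr_eq0; case: n n3 => [|[|[|]]].
pose La := 2 * S / n.-1%:R.
pose l u := (4 * dot (delta u) d - La) / n.-2%:R.
have en : n%:R = n.-2%:R + 2 :> R.
  by rewrite -natrD addn2; case: n n3 => [|[|]].
have en1 : n.-1%:R = n.-2%:R + 1 :> R.
  by rewrite natr1; case: n n3 => [|[|]].
have suml : \sum_u l u = La.
  rewrite -mulr_suml sumrB -mulr_sumr sumr_const card_ord -/S -(mulr_natr La) en.
  rewrite /La en1; rewrite en1 in nz1; field.
  by rewrite nz nz1.
exists l => u; rewrite dotBr dot_delta_potential suml -(mulr_natr (l u)) /l.
by field.
Qed.

Lemma L_Lperp0 x : L x -> Lperp x -> x = 0.
Proof. by move=> Lx h; apply: dot_eq0; exact: h. Qed.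

Lemma LB x y : L x -> L y -> L (x - y).
Proof. by move=> Lx Ly u; rewrite dotBr Lx Ly subrr. Qed.
Lemma LZ k x : L x -> L (k *: x).
Proof. by move=> Lx u; rewrite dotZr Lx mulr0. Qed.
Lemma LperpB x y : Lperp x -> Lperp y -> Lperp (x - y).
Proof. by move=> Lx Ly u Lu; rewrite dotBl Lx // Ly // subrr. Qed.

Lemma projL_spec d : L (projL d) /\ Lperp (d - projL d).
Proof.
have [l hl] := orth_decomposition d.
apply: (@xgetPex _ 0 [set y | L y /\ Lperp (d - y)]).
exists (d - potential l); split => //.
by rewrite opprB addrCA subrr addr0; exact: Lperp_potential.
Qed.

Lemma projL_potential b l : L b -> projL (b + potential l) = b.
Proof.
move=> Lb; have [h1 h2] := projL_spec (b + potential l).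
apply/eqP; rewrite -subr_eq0; apply/eqP/L_Lperp0; first exact: LB.
rewrite -(opprK (_ - b)); have -> : - (projL (b + potential l) - b) =
    (b + potential l - projL (b + potential l)) - potential l.
  by rewrite opprB [in RHS]addrAC addrK.
by move=> x Lx; rewrite dotNl LperpB ?oppr0 //; exact: Lperp_potential.
Qed.

Lemma min_triples_projL d : min_triples (projL d) = min_triples d.
Proof.
have [_ /LperpP [l hl]] := projL_spec d.
by rewrite -(min_triples_potential (projL d) l) -hl addrCA subrr addr0.
Qed.

(** The representative of a modulo Lperp whose minimal triangle slack is 0 at each
    vertex: the smallest shift of a into the metric cone. *)
Definition tt_form a : evec R n := a - potential (tmin^~ a).

Lemma potentialN l : - potential l = potential (fun u => - l u) :> evec R n.
Proof. by rewrite /potential -sumrN; apply: eq_bigr => u _; rewrite scaleNr. Qed.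

Lemma tri3_tt_form t a : distinct_triple t -> tri3 t (tt_form a) =
  tri3 t a - tmin t.1.1 a.
Proof. by move=> dt; rewrite tri3B tri3_potential. Qed.

Lemma metric_tt_form a : metric_cone (tt_form a).
Proof. by apply/metric3 => t dt; rewrite tri3_tt_form // subr_ge0 tmin_le. Qed.

Lemma projL_tt_form a : L a -> projL (tt_form a) = a.
Proof. by move=> La; rewrite /tt_form potentialN projL_potential. Qed.

Lemma tri3_tt_form_min_triples t a : t \in min_triples a -> tri3 t (tt_form a) = 0.
Proof. by rewrite inE => /andP [dt /eqP h]; rewrite tri3_tt_form // h subrr. Qed.

(** Triples with repeated vertices are given the trivial inequality 0 >= 0, so that
    the system is indexed by a whole finite type; the other systems below use the
    same device. *)
Definition metric_lhs t : evec R n := if distinct_triple t then tri_vec3 t else 0.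
Definition metric_rhs t : R := 0.

Lemma metric_solutions : metric_cone = solutions metric_lhs metric_rhs.
Proof.
apply/seteqP; split => d.
  move=> /metric3 h t; rewrite /metric_lhs /metric_rhs; case: ifP => [/h|_];
    last by rewrite dot0l.
  by rewrite tri3_dot.
move=> h; apply/metric3 => t dt; have := h t; rewrite /metric_lhs /metric_rhs dt.
by rewrite tri3_dot.
Qed.

Lemma active_metric t d : (t \in active metric_lhs metric_rhs d) =
  (distinct_triple t ==> (tri3 t d == 0)).
Proof.
rewrite inE /metric_lhs /metric_rhs; case: ifP => _ /=; last by rewrite dot0l eqxx.
by rewrite tri3_dot.
Qed.

Lemma tri_face_sys t : distinct_triple t ->
  tri_face t.1.1 t.1.2 t.2 = sys_face metric_lhs metric_rhs [set t]%SET.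
Proof.
move=> dt; rewrite /tri_face metric_solutions; apply/seteqP.
split=> d [sd h]; split => //; move: h; rewrite finset.sub1set active_metric dt.
  by move=> h; apply/eqP.
by move/eqP.
Qed.

Lemma metric_zero_min_triples d t : metric_cone d -> distinct_triple t -> tri3 t d = 0 ->
  t \in min_triples d.
Proof. by move=> /metric3 md dt h; apply/min_triplesP; split => // s ds _;
  rewrite h md. Qed.

(** If the face has a vanishing slack at each u, then the slacks which vanish at a
    metric d are its minimal ones, and these are not changed by the projection.
    The inverse of the projection on the face is tt_form. *)
Lemma projL_metric_face x : metric_cone x ->
  (forall u, exists t, [/\ distinct_triple t, t.1.1 = u & tri3 t x = 0]) ->
  projL @` (sys_face metric_lhs metric_rhs (active metric_lhs metric_rhs x)) =
  [set b | L b /\ min_triples (projL x) \subset min_triples b].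
Proof.
move=> mx zx; apply/seteqP; split.
  move=> _ [d [sd xd] <-]; split; first by have [] := projL_spec d.
  rewrite !min_triples_projL; apply/fintype.subsetP => t tx.
  have dt : distinct_triple t by move: tx; rewrite inE => /andP [].
  apply: metric_zero_min_triples => //; first by rewrite metric_solutions.
  have [s [ds es zs]] := zx t.1.1.
  have zt : tri3 t x = 0.
    by rewrite -zs; apply/esym/min_triples_eq => //; exact: metric_zero_min_triples.
  have : t \in active metric_lhs metric_rhs d.
    by apply: (fintype.subsetP xd); rewrite active_metric zt eqxx implybT.
  by rewrite active_metric dt => /eqP.
move=> b [Lb xb]; exists (tt_form b); last exact: projL_tt_form.
split; first by rewrite -metric_solutions; exact: metric_tt_form.
apply/fintype.subsetP => t; rewrite !active_metric;
  case dt: (distinct_triple t) => //= /eqP zt.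
apply/eqP; apply: tri3_tt_form_min_triples; apply: (fintype.subsetP xb).
by rewrite min_triples_projL; apply: metric_zero_min_triples.
Qed.

(** A nonempty member of the fan comes from a face of the metric cone which has, for
    each u, a slack that vanishes identically; this is what makes
    projL_metric_face applicable. *)
Lemma flat_TT_fanP F : F !=set0 -> flat_TT_fan R n F <->
  exists x, L x /\ F = [set b | L b /\ min_triples x \subset min_triples b].
Proof.
move=> F0; split.
  move=> [G ttG eF].
  have G0 : G !=set0 by move: F0; rewrite -eF => -[_ [d Gd _]]; exists d.
  pose u0 : 'I_n := Ordinal (ltn_trans (isT : (0 < 2)%N) n3).
  have tf u : exists t, [/\ distinct_triple t, t.1.1 =
    u & face (sys_face metric_lhs metric_rhs [set t]%SET) G].
    have [v [w [h f]]] := ttG u I; exists (u, v, w).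
    have dt : distinct_triple (u, v, w) by apply/(distinct_tripleP (u, v, w)).
    by rewrite -tri_face_sys.
  have [t0 [_ _ f0]] := tf u0.
  have [x [Gx eG]] := face_sys_face f0 G0.
  have zx u : exists t, [/\ distinct_triple t, t.1.1 = u & tri3 t x = 0].
    have [t [dt et f]] := tf u; exists t; split => //.
    have : t \in active metric_lhs metric_rhs x.
      move: Gx; have [c [g [_ ->]]] := f.
      by move=> [[_ /fintype.subsetP h] _]; apply: h; rewrite inE.
    by rewrite active_metric dt => /eqP.
  have mx : metric_cone x by rewrite metric_solutions; move: Gx; rewrite eG => -[].
  exists (projL x); split; first by have [] := projL_spec x.
  by rewrite -eF eG projL_metric_face.
move=> [x [Lx ->]].
have zx u : exists t, [/\ distinct_triple t, t.1.1 = u & tri3 t (tt_form x) = 0].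
  have [t [tx et]] := ex_min_triples u x; exists t; split => //.
    by move: tx; rewrite inE => /andP [].
  exact: tri3_tt_form_min_triples.
exists (sys_face metric_lhs metric_rhs (active metric_lhs metric_rhs (tt_form x)));
  last first.
  by rewrite projL_metric_face ?projL_tt_form //; exact: metric_tt_form.
move=> u _; have [t [dt et zt]] := zx u; exists t.1.2, t.2.
rewrite -et; split; first exact/distinct_tripleP.
rewrite tri_face_sys //; apply: sys_face_face.
by rewrite finset.sub1set active_metric zt eqxx implybT.
Qed.

End Minima.


(** * The polar of the traveling salesman polytope *)

Section Polar.
Context {R : realType} {n : nat}.
Hypothesis n3 : (2 < n)%N.
Implicit Types (u v w : 'I_n) (a b d q x y : evec R n) (C : {set edge n}).
Implicit Types (s t : @triple n).

Definition polar_index := ('I_n * bool + {set edge n})%type.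

Definition polar_lhs (i : polar_index) : evec R n :=
  match i with
  | inl (u, b) => if b then delta u else - delta u
  | inr C => if tour C then chi C - z else 0
  end.

Definition polar_rhs (i : polar_index) : R := if i is inr C then if tour C
  then -1 else 0 else 0.

(** These tours span the face of the polytope that is exposed by a, so tight_tours
    is a combinatorial name for the face of the polar that has a in its relative
    interior. *)
Definition tight_tours a : {set {set edge n}} :=
  [set C | tour C && (dot (chi C - z) a == -1)]%SET.

(** Validity on a convex hull can be tested on its generators. *)
Lemma polarSP a : polarS R n a <-> L a /\ forall C, tour C -> -1 <= dot (chi C - z) a.
Proof.
split=> [[La h]|[La h]]; split => //.
  by move=> C tC; have := h _ (STSP_tour tC); rewrite dotNl lerNl dotC.
move=> x Sx; have v : valid (STSP R n) a (dot a z - 1).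
  apply: convex_hull_valid => _ [s [hs ->]].
  by have := h _ (tour_cycle hs); rewrite dotC dotBr lerBrDl.
by have := v x Sx; rewrite dotNl dotBr; lra.
Qed.

Lemma polar_solutions : polarS R n = solutions polar_lhs polar_rhs.
Proof.
apply/seteqP; split => a.
  move=> /polarSP [La h] [[u []]|C] /=; rewrite /polar_rhs /=.
  - by rewrite La.
  - by rewrite dotNl La oppr0.
  - by case: ifP => [/h//|_]; rewrite dot0l.
move=> h; apply/polarSP; split => [u|C tC].
  apply/le_anti; rewrite (h (inl (u, true))) andbT.
  by have := h (inl (u, false)); rewrite /= dotNl oppr_ge0.
by have := h (inr C); rewrite /= tC.
Qed.

Lemma active_polar_l p x : polarS R n x -> inl p \in active polar_lhs polar_rhs x.
Proof.
case: p => u b [Lx _]; rewrite inE /=.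
by case: b; rewrite ?dotNl Lx ?oppr0.
Qed.

Lemma active_polar_r C x :
  (inr C \in active polar_lhs polar_rhs x) = (tour C ==> (C \in tight_tours x)).
Proof.
rewrite !inE /=; case: ifP => //= _; by rewrite dot0l eqxx.
Qed.

(** The equations defining L are always active and the trivial inequalities as well,
    so only the tours matter. *)
Lemma active_polar x y : polarS R n x -> polarS R n y ->
  (active polar_lhs polar_rhs x \subset active polar_lhs polar_rhs y) =
    (tight_tours x \subset tight_tours y).
Proof.
move=> px py; apply/fintype.subsetP/fintype.subsetP => h.
  move=> C Cx; have tC : tour C by move: Cx; rewrite inE => /andP [].
  have := h (inr C); rewrite !active_polar_r tC /= => H; exact: H.
move=> [p|C]; first by move=> _; exact: active_polar_l.
by rewrite !active_polar_r => /implyP H; apply/implyP => /H /h.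
Qed.

Lemma active_polar_eq x y : polarS R n x -> polarS R n y ->
  (active polar_lhs polar_rhs x == active polar_lhs polar_rhs y) =
    (tight_tours x == tight_tours y).
Proof. by move=> px py; rewrite !finset.eqEsubset !active_polar. Qed.

Lemma polar_sys0 : polarS R n = sys_face polar_lhs polar_rhs finset.set0.
Proof.
rewrite polar_solutions; apply/seteqP; split => x; last by case.
by move=> sx; split => //; exact: finset.sub0set.
Qed.

(** For a in the polar, this is the smallest face of the polar that contains a. *)
Definition polar_face a : set (evec R n) :=
  [set b | polarS R n b /\ tight_tours a \subset tight_tours b].

Lemma polar_face_sys a : polarS R n a ->
  polar_face a = sys_face polar_lhs polar_rhs (active polar_lhs polar_rhs a).
Proof.
move=> pa; apply/seteqP; split => b [pb h].
  by split; [rewrite -polar_solutions|rewrite active_polar].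
have pb' : polarS R n b by rewrite polar_solutions.
by split => //; rewrite -active_polar.
Qed.

Lemma face_polar_face a : polarS R n a -> face (polarS R n) (polar_face a).
Proof.
move=> pa; rewrite polar_face_sys // [X in face X _]polar_sys0.
by apply: sys_face_face; exact: finset.sub0set.
Qed.

Lemma polar_face_sub F a : face (polarS R n) F -> F a -> polar_face a `<=` F.
Proof.
move=> fF Fa; have pa : polarS R n a by case: fF Fa => c [g [_ ->]] [].
rewrite polar_face_sys //; apply: face_active Fa; rewrite polar_sys0 in fF; exact: fF.
Qed.

Lemma face_polarP F : face (polarS R n) F -> F !=set0 ->
  exists a, [/\ polarS R n a, F a & F = polar_face a].
Proof.
move=> fF F0; have := fF; rewrite [X in face X]polar_sys0 => /face_sys_face.
move=> /(_ F0) [a [Fa eF]]; exists a.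
have pa : polarS R n a by case: fF Fa => c [g [_ ->]] [].
by rewrite polar_face_sys.
Qed.

Lemma relint_polar_face a : polarS R n a ->
  relint (polar_face a) = [set b | polarS R n b /\ tight_tours b = tight_tours a].
Proof.
move=> pa; rewrite polar_face_sys // relint_sys_face -?polar_solutions //.
apply/seteqP; split => b [pb h]; split => //; apply/eqP.
  by rewrite -active_polar_eq // h.
by rewrite active_polar_eq // h.
Qed.

(** * Closed cells *)

Definition rot_index := (polar_index + @triple n * @triple n)%type.

(** That the triples of M have minimal slack is a system of linear inequalities
    tri_t - tri_s >= 0, with s in M and t a triple at the same vertex.  The set of
    minimal triples itself is not given by fixed linear inequalities, which is why
    the system depends on M. *)
Definition rot_lhs (M : {set @triple n}) (i : rot_index) : evec R n :=
  match i with
  | inl p => polar_lhs p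
  | inr (s, t) => if [&& s \in M, distinct_triple t
    & t.1.1 == s.1.1] then tri_vec3 t - tri_vec3 s else 0
  end.

Definition rot_rhs (i : rot_index) : R := if i is inl p then polar_rhs p else 0.

Lemma rot_solutions x :
  solutions (rot_lhs (min_triples x)) rot_rhs = [set b | polarS R n b /\
    min_triples x \subset min_triples b].
Proof.
rewrite polar_solutions; apply/seteqP; split => b.
  move=> h; split=> [p|]; first exact: (h (inl p)).
  apply/fintype.subsetP => s sx; apply/(min_triplesP n3); split.
    by move: sx; rewrite inE => /andP [].
  move=> t dt et; have := h (inr (s, t)); rewrite /rot_rhs /= sx dt et eqxx /=.
  by rewrite dotBl subr_ge0 -!tri3_dot.
move=> [sb /fintype.subsetP xb] [p|[s t]]; first exact: sb.
rewrite /rot_rhs /=; case: ifP => [/and3P [/xb /(min_triplesP n3) [ds h] dt /eqP et]|_].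
  by rewrite dotBl subr_ge0 -!tri3_dot h.
by rewrite dot0l.
Qed.

(** At each vertex x has a minimal triple s, which remains minimal at y and b; any
    other triple t is minimal if and only if the inequality for (s, t) is active. *)
Lemma rot_active x y b : polarS R n y -> min_triples x \subset min_triples y ->
  polarS R n b -> min_triples x \subset min_triples b ->
  (active (rot_lhs (min_triples x)) rot_rhs y \subset active (rot_lhs
    (min_triples x)) rot_rhs b)
  = (tight_tours y \subset tight_tours b) && (min_triples y \subset min_triples b).
Proof.
move=> py /fintype.subsetP xy pb /fintype.subsetP xb.
have inl_active p a : (inl p \in active (rot_lhs (min_triples x)) rot_rhs a) =
  (p \in active polar_lhs polar_rhs a).
  by rewrite !inE.
have inr_active s t a : s \in min_triples x -> distinct_triple t -> t.1.1 = s.1.1 ->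
    (inr (s, t) \in active (rot_lhs (min_triples x)) rot_rhs a) = (tri3 t a == tri3 s a).
  by move=> sx dt et; rewrite inE /rot_rhs /= sx dt et eqxx /= dotBl subr_eq0 -!tri3_dot.
apply/fintype.subsetP/andP => [h|[]].
  split.
    rewrite -active_polar //; apply/fintype.subsetP => p.
    by rewrite -!inl_active; apply: h.
  apply/fintype.subsetP => t ty; have [s [sx es]] := ex_min_triples n3 t.1.1 x.
  have dt : distinct_triple t by move: ty; rewrite inE => /andP [].
  apply: (min_triples_from (xb s sx)) => //; apply/esym/eqP.
  rewrite -inr_active //; apply: h; rewrite inr_active //; apply/eqP.
  by apply: min_triples_eq => //; exact: xy.
rewrite -active_polar // => /fintype.subsetP hp /fintype.subsetP hm [p|[s t]].
  by rewrite !inl_active; exact: hp.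
have [/and3P [sx dt /eqP et]|] := boolP [&& s \in min_triples x,
  distinct_triple t & t.1.1 == s.1.1].
  rewrite !inr_active // => /eqP e; apply/eqP/min_triples_eq => //; last exact: xb.
  by apply: hm; apply: (min_triples_from (xy s sx)).
by move=> /negbTE hh _; rewrite inE /rot_rhs /= hh dot0l eqxx.
Qed.

Lemma rot_active_eq x y b : polarS R n y -> min_triples x \subset min_triples y ->
  polarS R n b -> min_triples x \subset min_triples b ->
  (active (rot_lhs (min_triples x)) rot_rhs y == active (rot_lhs
    (min_triples x)) rot_rhs b)
  = (tight_tours y == tight_tours b) && (min_triples y == min_triples b).
Proof.
move=> py xy pb xb; rewrite !finset.eqEsubset !rot_active //.
by rewrite andbACA.
Qed.

(** The closed cell of a: tight tours stay tight and minimal slacks stay minimal. *)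
Definition rot_face a : set (evec R n) :=
  [set b | [/\ polarS R n b, tight_tours a \subset tight_tours b & min_triples a
    \subset min_triples b]].

(** Equality in place of the inclusions gives the relative interior of rot_face. *)
Definition rot_cell a : set (evec R n) :=
  [set b | [/\ polarS R n b, tight_tours b = tight_tours a & min_triples b =
    min_triples a]].

Lemma rot_face_sys x y : polarS R n y -> min_triples x \subset min_triples y ->
  rot_face y = sys_face (rot_lhs (min_triples x)) rot_rhs (active (rot_lhs
    (min_triples x)) rot_rhs y).
Proof.
move=> py xy; apply/seteqP; split => b.
  move=> [pb tb mb]; have xb := fintype.subset_trans xy mb.
  by split; [rewrite rot_solutions|rewrite rot_active // tb mb].
rewrite /sys_face rot_solutions => -[[pb xb]].
by rewrite rot_active // => /andP [].
Qed.

Lemma rot_sol_refl a : polarS R n a -> solutions (rot_lhs (min_triples a)) rot_rhs a.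
Proof. by move=> pa; rewrite rot_solutions. Qed.

Lemma cell_sys a : polarS R n a -> rot_cell a =
  [set y | solutions (rot_lhs (min_triples a)) rot_rhs y /\
           active (rot_lhs (min_triples a)) rot_rhs y =
             active (rot_lhs (min_triples a)) rot_rhs a].
Proof.
move=> pa; rewrite rot_solutions; apply/seteqP; split => b.
  move=> [pb tb mb]; split; first by split => //; rewrite mb.
  by apply/eqP; rewrite rot_active_eq ?mb ?tb ?eqxx.
move=> [[pb mb] /eqP]; rewrite rot_active_eq // => /andP [/eqP ? /eqP ?].
by split.
Qed.

Lemma closure_cell a : polarS R n a -> closure (rot_cell a) = rot_face a.
Proof.
move=> pa; rewrite cell_sys // closure_active; last exact: rot_sol_refl.
by rewrite -rot_face_sys.
Qed.

Lemma relint_rot_face a : polarS R n a -> relint (rot_face a) = rot_cell a.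
Proof.
move=> pa; rewrite (@rot_face_sys a) // relint_sys_face -?cell_sys //.
exact: rot_sol_refl.
Qed.

Lemma polyhedron_rot_face a : polarS R n a -> polyhedron (rot_face a).
Proof. by move=> pa; rewrite (@rot_face_sys a) //; exact: sys_face_polyhedron. Qed.

Lemma rot_face_face a x : polarS R n a -> rot_face a x -> face (rot_face a) (rot_face x).
Proof.
move=> pa [px tx mx]; rewrite (@rot_face_sys a x) // (@rot_face_sys a a) //.
by apply: sys_face_face; rewrite rot_active // tx.
Qed.

Lemma face_rot_face a F : polarS R n a -> face (rot_face a) F -> F !=set0 ->
  exists x, rot_face a x /\ F = rot_face x.
Proof.
move=> pa fF F0; have ra := @rot_face_sys a a pa (fintype.subxx _).
have fF' := fF; rewrite ra in fF'.
have [x [Fx eF]] := face_sys_face fF' F0.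
have ax : rot_face a x by case: fF Fx => c [g [_ ->]] [].
by exists x; split => //; have [px tx mx] := ax; rewrite (@rot_face_sys a x).
Qed.

Lemma tight_tours_mid (T0 : {set {set edge n}}) x y : T0 \subset tight_tours x ->
  T0 \subset tight_tours y -> T0 \subset tight_tours (midpoint x y).
Proof.
move=> /fintype.subsetP hx /fintype.subsetP hy; apply/fintype.subsetP => C CT.
have := hx C CT; have := hy C CT; rewrite !inE dot_mid.
by move=> /andP [-> /eqP ->] /andP [_ /eqP ->] /=; apply/eqP; lra.
Qed.

(** Sets of the form of rot_face, but with prescribed index sets, are again closed
    cells; this serves both for the intersection of two closed cells and for the
    intersection of a face of the polar with a cone of the flat TT-fan.  The
    hypothesis on x provides a system that describes the set, so that it has a
    point with least active set. *)
Lemma least_rot_face x (T0 : {set {set edge n}}) (M0 : {set @triple n}) :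
  min_triples x \subset M0 ->
  let H := [set b | [/\ polarS R n b, T0 \subset tight_tours b & M0
    \subset min_triples b]] in
  H !=set0 -> exists y, H y /\ H = rot_face y.
Proof.
move=> xM H H0.
have [||y [Hy hy]] := @ex_least_active _ _ _ (rot_lhs (min_triples x)) rot_rhs H _ H0.
- move=> b [pb tb mb]; rewrite rot_solutions; split => //.
  exact: fintype.subset_trans mb.
- move=> b c [pb tb mb] [pc' tc' mc']; split.
  + rewrite polar_solutions; apply: solutions_mid; by rewrite -polar_solutions.
  + exact: tight_tours_mid.
  + exact: min_triples_mid.
have [py ty my] := Hy; have xy := fintype.subset_trans xM my.
exists y; split => //; apply/seteqP; split => b.
  move=> Hb; have [pb tb mb] := Hb; have := hy b Hb.
  rewrite rot_active //; last exact: fintype.subset_trans mb.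
  by move=> /andP [? ?]; split.
move=> [pb tb mb]; split => //; first exact: fintype.subset_trans tb.
exact: fintype.subset_trans mb.
Qed.

End Polar.


(** * Rotating inequalities onto the graphical polyhedron *)

Section Main.
Context {R : realType} {n : nat}.
Hypothesis n5 : (4 < n)%N.
Implicit Types (u v w : 'I_n) (a b d q x y : evec R n) (C : {set edge n}).
Implicit Types (s t : @triple n).

Let n3 : (2 < n)%N. Proof. exact: ltn_trans n5. Qed.

Local Notation dl_points := (support_of (dlN R n)).

Lemma dl_polar a : dl_points a -> polarS R n a.
Proof. by move=> [F [[c [g [_ ->]]] _] []]. Qed.

(** A face that contains a contains the smallest one that does. *)
Lemma dl_upward a b : dl_points a -> polarS R n b ->
  tight_tours a \subset tight_tours b -> dl_points b.
Proof.
move=> [F [fF FN] Fa] pb ab; exists F; first by split.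
by apply: (polar_face_sub fF Fa); split.
Qed.

Lemma dl_polar_face a : dl_points a -> dlN R n (polar_face a).
Proof.
move=> Da; have pa := dl_polar Da; have [F [fF FN] Fa] := Da.
split; first exact: face_polar_face.
apply/seteqP; split => // b [hb Nb]; rewrite -FN; split => //.
exact: (polar_face_sub fF Fa hb).
Qed.

Lemma dot_z_L x : L x -> dot x z = 0.
Proof.
move=> Lx; rewrite dotC; suff -> : z = potential (fun=> 2 / n.-1%:R) :> evec R n.
  by apply: Lperp_potential.
apply: entry_ext => u v uv; rewrite entry_potential //.
have [e he] := edge_of uv; rewrite (entry_coord _ he) /coord mxE.
by lra.
Qed.

(** The vertex of the polar that corresponds to the inequality x_e >= 0; the factor
    normalizes the right-hand side, since z has the coordinate 2 / (n-1) at e. *)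
Definition edge_vertex (e : edge n) : evec R n :=
  (n.-1%:R / 2) *: projL (chi [set e]%SET).

Lemma coord_z (e : edge n) : coord (z : evec R n) e = 2 / n.-1%:R.
Proof. by rewrite /coord mxE. Qed.

Lemma dot_unit e x : dot x (chi [set e]%SET) = coord x e.
Proof.
rewrite dot_coord (bigD1 e) //= coord_chi inE eqxx mulr1 big1 ?addr0 // => f fe.
by rewrite coord_chi inE (negbTE fe) mulr0.
Qed.

Lemma n1_neq0 : n.-1%:R != 0 :> R.
Proof. by rewrite pnatr_eq0; move: n5; clear; case: n => [|[|]]. Qed.

Lemma dot_edge_vertex e x : L (x - z) ->
  dot (x - z) (edge_vertex e) = n.-1%:R / 2 * coord x e - 1.
Proof.
move=> Lx; rewrite dotZr; have [_ h] := @projL_spec R n n3 (chi [set e]%SET).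
have := h _ Lx; rewrite dotC dotBr dot_unit => /eqP; rewrite subr_eq0 => /eqP <-.
have -> : coord (x - z) e = coord x e - 2 / n.-1%:R by rewrite -(coord_z e) /coord !mxE.
by field; exact: n1_neq0.
Qed.

Lemma STSP_sub_z x : STSP R n x -> L (x - z).
Proof.
move=> Sx u; rewrite dotBr dot_delta_z //; apply/eqP; rewrite subr_eq0; apply/eqP.
have v1 : valid (STSP R n) (delta u) 1.
  by apply: convex_hull_valid => _ [s [hs ->]]; rewrite dot_delta_tour // tour_cycle.
have v2 : valid (STSP R n) (- delta u) (- 1).
  by apply: convex_hull_valid => _ [s [hs ->]];
    rewrite dotNl dot_delta_tour // tour_cycle.
by apply/le_anti; rewrite (v1 x Sx) andbT; have := v2 x Sx; rewrite dotNl lerN2.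
Qed.

Lemma tight_edge_vertex e C : (C \in tight_tours (edge_vertex e)) =
  tour C && (e \notin C).
Proof.
rewrite inE; case tC: (tour C) => //=.
rewrite dot_edge_vertex ?coord_chi; last exact: tour_sub_z.
case: (e \in C) => /=; last by rewrite mulr0 sub0r eqxx.
rewrite mulr1 -subr_eq0 opprK subrK mulf_eq0 (negbTE n1_neq0) invr_eq0.
by rewrite pnatr_eq0.
Qed.

Lemma polar_edge_vertex e : polarS R n (edge_vertex e).
Proof.
apply/polarSP; split.
  by apply: LZ; have [] := @projL_spec R n n3 (chi [set e]%SET).
move=> C tC; rewrite dot_edge_vertex ?coord_chi; last exact: tour_sub_z.
by rewrite lerDr mulr_ge0 // divr_ge0.
Qed.

(** By rigidity, no other point of the polar is tight at all tours that avoid e. *)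
Lemma N_edge_vertex e : N R n (edge_vertex e).
Proof.
have pe := polar_edge_vertex e; split.
  rewrite /vertex; suff <- : polar_face (edge_vertex e) = [set edge_vertex e].
    exact: face_polar_face.
  apply/seteqP; split => [b [pb hb]|_ ->]; last by split.
  have [Le _] := pe; have [Lb _] := pb.
  have Ld : L (b - edge_vertex e) by exact: LB.
  apply/eqP; rewrite -subr_eq0; apply/eqP.
  apply: (@rigidity R n n5 _ e Ld) => C tC eC.
  have Ce : C \in tight_tours (edge_vertex e) by rewrite tight_edge_vertex tC.
  have Cb := fintype.subsetP hb C Ce.
  have : dot (chi C - z) (b - edge_vertex e) = 0.
    by move: Ce Cb; rewrite dotBr !inE => /andP [_ /eqP ->] /andP [_ /eqP ->];
      rewrite subrr.
  by rewrite dotC dotBr (dot_z_L Ld) subr0.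
exists e; apply/seteqP; split => x [Sx h]; split => //.
  have := dot_edge_vertex e (STSP_sub_z Sx); rewrite dotC dotBr h addrAC subrr add0r.
  move/eqP; rewrite eq_sym -subr_eq0 opprK subrK mulf_eq0 mulf_eq0.
  by rewrite (negbTE n1_neq0) invr_eq0 pnatr_eq0 /= => /eqP.
have := dot_edge_vertex e (STSP_sub_z Sx).
by rewrite h mulr0 sub0r dotC dotBr => /eqP; rewrite subr_eq addrC => /eqP.
Qed.

(** If no tight tour of a used e, then the vertex for x_e >= 0 would lie in the
    smallest face containing a, which has no vertex in N. *)
Lemma dl_tour_through a e : dl_points a -> exists C, C \in tight_tours a /\ e \in C.
Proof.
move=> [F [fF FN] Fa]; apply: contrapT => h.
have : (F `&` N R n) (edge_vertex e); last by rewrite FN.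
split; last exact: N_edge_vertex.
apply: (polar_face_sub fF Fa); split; first exact: polar_edge_vertex.
apply/fintype.subsetP => C Ca; rewrite tight_edge_vertex.
have -> : tour C by move: Ca; rewrite inE => /andP [].
by apply/negP => eC; apply: h; exists C.
Qed.

Definition rot_bound a q : R := dot a z - 1 + dot q z.

(** Elements of Lperp are constant on the affine hull of the polytope, so adding
    them does not change the slacks at tours. *)
Lemma tour_slack a q C : Lperp q -> tour C ->
  dot (a + q) (chi C) = rot_bound a q + (dot (chi C - z) a + 1).
Proof.
move=> Lq tC; have := Lq _ (tour_sub_z n3 tC); rewrite dotBr => /eqP.
rewrite subr_eq0 => /eqP h; rewrite dotDl h /rot_bound dotBl (dotC z) (dotC (chi C)).
by ring.
Qed.

Lemma tight_tour a q C : Lperp q -> tour C ->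
  (C \in tight_tours a) = (dot (a + q) (chi C) == rot_bound a q).
Proof.
move=> Lq tC; rewrite inE tC tour_slack //=.
by rewrite -[X in _ = (_ == X)]addr0 (inj_eq (addrI _)) addr_eq0.
Qed.

Lemma valid_rotation a q : polarS R n a -> Lperp q -> metric_cone (a + q) ->
  valid (GTSP R n) (a + q) (rot_bound a q).
Proof.
move=> /polarSP [_ pa] Lq mq; apply: metric_valid_GTSP => // C tC.
by rewrite tour_slack // lerDl -[1]opprK subr_ge0 pa.
Qed.

(** The converse of valid_rotation.  Take a tight tour through vw and replace this
    edge by a detour through u: the slack of the resulting point is the triangle
    slack. *)
Lemma rotation_metric a q : dl_points a -> Lperp q ->
  valid (GTSP R n) (a + q) (rot_bound a q) -> metric_cone (a + q).
Proof.
move=> Da Lq vq; apply/metric3 => t dt.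
have /distinct_tripleP dt' := dt; have [_ _ /eqP vw] := dt'.
have [e he] := edge_of vw; have [C [Ca eC]] := dl_tour_through e Da.
have tC : tour C by move: Ca; rewrite inE => /andP [].
have [y [Gy hy]] := @detour R n n3 C e _ _ _ tC eC he dt'.
by have := vq y Gy; rewrite hy; rewrite (tight_tour a Lq tC) in Ca;
  rewrite (eqP Ca) lerDl.
Qed.

(** The hypotheses say that every triangle slack and every tour slack that vanishes
    for the first inequality vanishes for the second.  Hence the first minus a
    small multiple of the second still comes from a metric and is valid on tours,
    so it is valid for the graphical polyhedron.  At a point where the first
    inequality is tight, the second one must then be tight, too. *)
Lemma tight_transfer a b l l' y : polarS R n a -> polarS R n b ->
  tight_tours a \subset tight_tours b -> min_triples a \subset min_triples b ->
  (forall u, l u + tmin u a = l' u + tmin u b) ->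
  metric_cone (a + potential l) -> metric_cone (b + potential l') ->
  GTSP R n y -> dot (a + potential l) y = rot_bound a (potential l) ->
  dot (b + potential l') y = rot_bound b (potential l').
Proof.
set q := potential l; set q' := potential l'.
move=> pa pb /fintype.subsetP tab /fintype.subsetP mab hl mq mq' Gy ey.
have Lq : Lperp q by exact: Lperp_potential.
have Lq' : Lperp q' by exact: Lperp_potential.
have /polarSP [_ ha] := pa; have /polarSP [_ hb] := pb.
have trq c m t : distinct_triple t -> tri3 t (c + potential m) = tri3 t c + m t.1.1.
  by move=> dt; rewrite tri3D tri3_potential.
have [||ep [ep0 hep]] := @ex_small_multiplier R (triple + {set edge n})%type
  (fun i => match i with inl t => if distinct_triple t then tri3 t (a + q) else 0
            | inr C => if tour C then dot (chi C - z) a + 1 else 0 end)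
  (fun i => match i with inl t => if distinct_triple t then tri3 t (b + q') else 0
            | inr C => if tour C then dot (chi C - z) b + 1 else 0 end).
- move=> [t|C]; case: ifP => //.
    by move: mq => /metric3; exact.
  by move=> /ha h; rewrite -[1]opprK subr_ge0.
- move=> [t|C]; case: ifP => //.
    move=> dt h0; have ta : t \in min_triples a.
      apply/(min_triplesP n3); split => // s ds es.
      have /metric3 /(_ s ds) := mq; rewrite -h0 !trq // es; lra.
    have := mab t ta; rewrite inE => /andP [_ /eqP hb'].
    move: ta; rewrite inE => /andP [_ /eqP ha'].
    by move: h0; rewrite !trq // ha' hb' addrC hl addrC => ->.
  move=> tC h0; have : C \in tight_tours a by rewrite inE tC -addr_eq0 h0 /=.
  by move=> /tab; rewrite inE => /andP [_ /eqP ->]; rewrite addNr.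
have mc' : metric_cone (a + q - ep *: (b + q')).
  apply/metric3 => t dt; rewrite tri3B tri3Z subr_ge0.
  by have := hep (inl t); rewrite dt.
have vc : valid (GTSP R n) (a + q - ep *: (b + q')) (rot_bound a q - ep * rot_bound b q').
  apply: metric_valid_GTSP => // C tC; rewrite dotBl dotZl !tour_slack //.
  by have := hep (inr C); rewrite tC; lra.
have := vc y Gy; rewrite dotBl dotZl ey lerD2l lerN2 ler_pM2l // => h1.
by apply/le_anti; rewrite h1 /=; exact: valid_rotation.
Qed.

(** The rotations of a are given by nonnegative node weights added to tt_form a;
    adding the same weights to tt_form b exposes the same face. *)
Lemma rotF_sub a b : dl_points a -> polarS R n b -> tight_tours a = tight_tours b ->
  min_triples a = min_triples b ->
  rotF a `<=` rotF b.
Proof.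
move=> Da pb tab mab F [fF [q [Lq vq eF]]]; split => //.
have pa := dl_polar Da; have mq := rotation_metric Da Lq vq.
have [l el] := LperpP n3 Lq; subst q.
(* Both inequalities then have the minimal slack l u + tmin u a at u. *)
pose l' u := l u + tmin u a - tmin u b.
have hl u : l u + tmin u a = l' u + tmin u b by rewrite /l' subrK.
have mq' : metric_cone (b + potential l').
  apply/metric3 => t dt; rewrite tri3D tri3_potential //.
  have [s [sa es]] := ex_min_triples n3 t.1.1 a.
  have ds : distinct_triple s by move: sa; rewrite inE => /andP [].
  have /metric3 /(_ s ds) := mq; rewrite tri3D tri3_potential // es.
  have -> : tri3 s a = tmin t.1.1 a by move: sa; rewrite inE es => /andP [_ /eqP].
  by have := tmin_le n3 b dt; rewrite /l'; lra.
exists (potential l'); split.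
- exact: Lperp_potential.
- by apply: valid_rotation => //; exact: Lperp_potential.
rewrite eF; apply/seteqP; split => y [Gy ey]; split => //.
- by apply: (@tight_transfer a b l l'); rewrite ?tab ?mab.
- by apply: (@tight_transfer b a l' l); rewrite ?tab ?mab.
Qed.

Lemma tt_form_sub a : a + (tt_form a - a) = tt_form a.
Proof. by rewrite addrC subrK. Qed.

Lemma Lperp_tt_form a : Lperp (tt_form a - a).
Proof.
by rewrite /tt_form addrAC subrr add0r potentialN; exact: Lperp_potential.
Qed.

Lemma rotF_max a : dl_points a -> exists2 F, rotF a F &
  F = [set x | GTSP R n x /\ dot (tt_form a) x = rot_bound a (tt_form a - a)].
Proof.
move=> Da; have pa := dl_polar Da.
have eq := tt_form_sub a; have Lq := Lperp_tt_form a.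
have v : valid (GTSP R n) (tt_form a) (rot_bound a (tt_form a - a)).
  by rewrite -{1}eq; apply: valid_rotation => //; rewrite eq; exact: metric_tt_form.
eexists; last reflexivity; split; first by exists (tt_form a),
  (rot_bound a (tt_form a - a)).
by exists (tt_form a - a); rewrite eq.
Qed.

(** The face exposed by tt_form a contains precisely the tight tours of a.  It also
    contains the detour of a tight tour through vw by u precisely if the triple
    (u, v, w) is minimal. *)
Lemma rotF_inj a b : dl_points a -> dl_points b -> rotF a `<=` rotF b ->
  tight_tours a = tight_tours b /\ min_triples a \subset min_triples b.
Proof.
move=> Da Db sub; have [F rF eF] := rotF_max Da.
have [_ [q [Lq vq eF']]] := sub F rF.
have eq := tt_form_sub a; have La := Lperp_tt_form a.
have Fa y : GTSP R n y -> (dot (tt_form a) y = rot_bound a (tt_form a - a)) <-> dot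
  (b + q) y = rot_bound b q.
  move=> Gy; have [h1 h2] : (F y -> dot (b + q) y = rot_bound b q) /\
    (dot (b + q) y = rot_bound b q -> F y).
    by rewrite eF'; split => // -[].
  split=> h; first by apply: h1; rewrite eF.
  by have := h2 h; rewrite eF => -[].
have tE : tight_tours a = tight_tours b.
  apply/finset.setP => C; have [tC|tC] := boolP (tour C);
    last by rewrite !inE (negbTE tC).
  rewrite (tight_tour a La tC) (tight_tour b Lq tC) eq.
  by apply/eqP/eqP => /(Fa _ (GTSP_tour n3 tC)).
split => //; have mq := rotation_metric Db Lq vq.
apply/fintype.subsetP => t ta.
have dt : distinct_triple t by move: ta; rewrite inE => /andP [].
have /distinct_tripleP dt' := dt; have [_ _ /eqP vw] := dt'.
have [e he] := edge_of vw; have [C [Ca eC]] := dl_tour_through e Da.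
have tC : tour C by move: Ca; rewrite inE => /andP [].
have [y [Gy hy]] := @detour R n n3 C e _ _ _ tC eC he dt'.
have Cb : C \in tight_tours b by rewrite -tE.
rewrite (tight_tour a La tC) eq in Ca; rewrite (tight_tour b Lq tC) in Cb.
have : dot (tt_form a) y = rot_bound a (tt_form a - a).
  by rewrite hy (eqP Ca) -[tri _ _ _ _]/(tri3 t
    (tt_form a)) tri3_tt_form_min_triples // addr0.
move=> /(Fa y Gy); rewrite hy (eqP Cb) => /eqP.
rewrite -[X in _ == X]addr0 (inj_eq (addrI _)) => /eqP z0.
have [l el] := LperpP n3 Lq; rewrite -(min_triples_potential n3 b l) -el.
by apply: metric_zero_min_triples.
Qed.

(** The faces obtained by rotation carry the same information as the tight tours and
    the minimal triples, so the partition into cells is a combinatorial one. *)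
Lemma rotF_eq a b : dl_points a -> dl_points b ->
  rotF a = rotF b <-> tight_tours a = tight_tours b /\ min_triples a = min_triples b.
Proof.
move=> Da Db; split=> [h|[ht hm]].
  have [|ht hm] := rotF_inj Da Db; first by rewrite h.
  have [|_ hm'] := rotF_inj Db Da; first by rewrite h.
  by split => //; apply/eqP; rewrite finset.eqEsubset hm hm'.
by apply/seteqP; split; apply: rotF_sub => //; exact: dl_polar.
Qed.

Lemma rot_cell_eq a : dl_points a -> [set b | dl_points b /\
  rotF b = rotF a] = rot_cell a.
Proof.
move=> Da; apply/seteqP; split => b.
  by move=> [Db /(rotF_eq Db Da) [? ?]]; split => //; exact: dl_polar.
move=> [pb tb mb]; have Db : dl_points b by apply: (dl_upward Da pb); rewrite tb.
by split => //; apply/(rotF_eq Db Da).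
Qed.

Lemma rot_cellsE : rot_cells R n = [set rot_cell a | a in dl_points].
Proof.
apply/seteqP; split => _ [a Da <-]; exists a => //.
  by rewrite rot_cell_eq.
by rewrite rot_cell_eq.
Qed.

Lemma rot_complexE : rot_complex R n = [set rot_face a | a in dl_points].
Proof.
rewrite /rot_complex rot_cellsE; apply/seteqP; split.
  move=> _ [_ [a Da <-] <-]; exists a => //.
  by rewrite closure_cell //; exact: dl_polar.
move=> _ [a Da <-]; exists (rot_cell a); first by exists a.
by rewrite closure_cell //; exact: dl_polar.
Qed.

(** Closed cells are determined by subsets of two finite types. *)
Lemma rot_complex_finite : finite_set (rot_complex R n).
Proof.
rewrite rot_complexE.
pose f (p : {set {set edge n}} * {set @triple n}) : set (evec R n) :=
  [set b | [/\ polarS R n b, p.1 \subset tight_tours b & p.2 \subset min_triples b]].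
apply: (@sub_finite_set _ _ (f @` setT)); last exact: finite_image.
by move=> _ [a Da <-]; exists (tight_tours a, min_triples a).
Qed.

(** The intersection imposes both sets of tight tours and both sets of minimal
    triples, so least_rot_face applies unless it is empty. *)
Lemma rot_complex_inter F G : rot_complex R n F -> rot_complex R n G ->
  face F (F `&` G).
Proof.
rewrite rot_complexE => -[a Da <-] [b Db <-].
have pa := dl_polar Da.
have [->|/set0P ne] := eqVneq (rot_face a `&` rot_face b) set0.
  exists 0, (-1); split; first by move=> x _; rewrite dot0l oppr_le0.
  apply/seteqP; split => // x [_]; rewrite dot0l => /eqP.
  by rewrite eq_sym oppr_eq0 oner_eq0.
have eI : rot_face a `&` rot_face b = [set x | [/\ polarS R n x,
    tight_tours a :|: tight_tours b \subset tight_tours x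
      & min_triples a :|: min_triples b \subset min_triples x]].
  apply/seteqP; split => x /=.
    by move=> [[px t1 m1] [_ t2 m2]]; rewrite !finset.subUset t1 m1 t2 m2.
  by rewrite !finset.subUset => -[px /andP [t1 t2] /andP [m1 m2]]; split.
have [y [Hy eH]] := @least_rot_face R n n3 a (tight_tours a :|: tight_tours b)
  (min_triples a :|: min_triples b)
  (finset.subsetUl _ _) (eq_ind _ (fun X => X !=set0) ne _ eI).
rewrite eI eH; apply: rot_face_face => //.
by move: Hy; rewrite -[X in X y -> _]eI => -[].
Qed.

Lemma rot_complex_complex : polyhedral_complex (rot_complex R n).
Proof.
split.
- exact: rot_complex_finite.
- rewrite rot_complexE => _ [a Da <-]; apply: polyhedron_rot_face => //; exact: dl_polar.
- rewrite rot_complexE => _ G [a Da <-] fG G0.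
  have [x [[px tx mx] ->]] := face_rot_face n3 (dl_polar Da) fG G0.
  by exists x => //; exact: dl_upward Da px tx.
- move=> F G cF cG; split; first exact: rot_complex_inter.
  by rewrite setIC; exact: rot_complex_inter.
Qed.

Lemma closure_cells : {in rot_cells R n, cancel closure relint}.
Proof.
move=> X; rewrite inE rot_cellsE => -[a Da <-].
by rewrite closure_cell ?relint_rot_face //; exact: dl_polar.
Qed.

Lemma relint_faces : {in rot_complex R n, cancel relint closure}.
Proof.
move=> X; rewrite inE rot_complexE => -[a Da <-].
by rewrite relint_rot_face ?closure_cell //; exact: dl_polar.
Qed.

Lemma set_bij_closure : set_bij (rot_cells R n) (rot_complex R n) closure.
Proof.
split.
- by move=> X cX; exists X.
- exact: (can_in_inj closure_cells).
- by move=> _ [X cX <-]; exists X.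
Qed.

Lemma set_bij_relint : set_bij (rot_complex R n) (rot_cells R n) relint.
Proof.
split.
- by move=> _ [X cX <-]; rewrite closure_cells ?inE.
- exact: (can_in_inj relint_faces).
- move=> X cX; exists (closure X); first by exists X.
  by rewrite closure_cells ?inE.
Qed.

(** The two conditions that define a closed cell are membership in a face of the
    polar and in a cone of the flat TT-fan. *)
Lemma rot_complex_refinement :
  eq_complex (rot_complex R n) (refinement (dlN R n) (flat_TT_fan R n)).
Proof.
apply/seteqP; split => H [cH H0]; split => //.
  move: cH; rewrite rot_complexE => -[a Da <-].
  exists (polar_face a), [set b | L b /\ min_triples a \subset min_triples b]; split.
  - exact: dl_polar_face.
  - have [La _] := dl_polar Da.
    by apply/(flat_TT_fanP n3); [exists a|exists a].
  - by apply/seteqP; split => b [] => [pb tb mb|[pb tb] [Lb mb]]; split => //;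
    have [] := pb.
have {H0} Hne : H !=set0 by apply/set0P/eqP => h; apply: H0.
have [F [G [[fF FN] tG eH]]] := cH.
have [x0 [Fx0 Gx0]] : (F `&` G) !=set0 by rewrite -eH.
have [a [pa Fa eF]] := face_polarP fF (ex_intro _ x0 Fx0).
have [x [Lx eG]] := (flat_TT_fanP n3 (ex_intro _ x0 Gx0)).1 tG.
have eH' : H = [set b | [/\ polarS R n b, tight_tours a
  \subset tight_tours b & min_triples x \subset min_triples b]].
  rewrite eH eF eG; apply/seteqP; split => b.
    by move=> [[pb tb] [Lb mb]]; split.
  by move=> [pb tb mb]; split => //; split => //; have [] := pb.
have := @least_rot_face R n n3 x (tight_tours a) (min_triples x) (fintype.subxx _).
rewrite /= -eH' => /(_ Hne) [y [Hy ->]].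
rewrite rot_complexE; exists y => //; exists F => //.
by rewrite eF; have [py ty _] := Hy.
Qed.

Lemma same_rot_face a b : dl_points a -> dl_points b ->
  ((exists F, [/\ rot_complex R n F, relint F a & relint F b]) <->
     ((exists F, [/\ face (polarS R n) F, relint F a & relint F b]) /\
      forall u : 'I_n, Eu u a = Eu u b)).
Proof.
move=> Da Db; have pa := dl_polar Da; have pb := dl_polar Db; split.
  move=> [F []]; rewrite rot_complexE => -[c Dc <-].
  have pc := dl_polar Dc; rewrite relint_rot_face // => -[_ ta ma] [_ tb mb].
  split; last by apply/EuP; rewrite ma mb.
  exists (polar_face c); rewrite relint_polar_face //; split => //.
  exact: face_polar_face.
move=> [[F [fF ra rb]] /EuP hm].
have Fa : F a by case: ra.
have [c [pc Fc eF]] := face_polarP fF (ex_intro _ a Fa).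
move: ra rb; rewrite eF relint_polar_face // => -[_ ta] [_ tb].
exists (rot_face a); rewrite rot_complexE relint_rot_face //; split => //.
- by exists a.
- by split => //; rewrite tb ta.
Qed.

End Main.

Theorem theorem3p2 (R : realType) (n : nat) (hn : (5 <= n)%N) :
  polyhedral_complex (rot_complex R n) /\
  [/\ set_bij (rot_cells R n) (rot_complex R n) closure,
      set_bij (rot_complex R n) (rot_cells R n) relint,
      {in rot_cells R n, cancel closure relint}
    & {in rot_complex R n, cancel relint closure}] /\
  eq_complex (rot_complex R n) (refinement (dlN R n) (flat_TT_fan R n)) /\
  (forall a b : evec R n, support_of (dlN R n) a -> support_of (dlN R n) b ->
    ((exists F, [/\ rot_complex R n F, relint F a & relint F b]) <->
     ((exists F, [/\ face (polarS R n) F, relint F a & relint F b]) /\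
      forall u : 'I_n, Eu u a = Eu u b))).
Proof.
split; first exact: rot_complex_complex.
split; first split.
- exact: set_bij_closure.
- exact: set_bij_relint.
- exact: closure_cells.
- exact: relint_faces.
split; first exact: rot_complex_refinement.
by move=> a b; exact: same_rot_face.
Qed.
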